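(* Let $u:(M,g,\nabla^M)\to(N,h,\nabla^N)$ be a statistical hypersurface, that is, $(g,\nabla^M)$ is the statistical structure on $M$ induced by the immersion $u$ from $(h,\nabla^N)$, and $m=\dim M=n-1$ with $n=\dim N$. Suppose that $(N,h,\nabla^N)$ is trace-free and satisfies $$\operatorname{Ric}^N-\overline{\operatorname{Ric}}^N-2\operatorname{Ric}^h\ge0,$$ i.e. $\operatorname{Ric}^N(X,X)-\overline{\operatorname{Ric}}^N(X,X)-2\operatorname{Ric}^h(X,X)\ge0$ for every tangent vector $X$ of $N$. If $u$ is a statistical biharmonic map such that $K^N\bigl(\tau(u),\tau(u)\bigr)=0$, and $\|\tau(u)\|_h$ is constant on $M$, then $\tau(u)=0$.
   Context: All objects are smooth; $M$ has dimension $m\ge2$ (not assumed compact). A statistical manifold $(M,g,\nabla)$ is a Riemannian manifold $(M,g)$ with a torsion-free affine connection $\nabla$ such that $(\nabla_Xg)(Y,Z)=(\nabla_Yg)(X,Z)$ for all vector fields $X,Y,Z$. Write $\nabla^g$ for the Levi-Civita connection of $g$, $K(X,Y)=\nabla_XY-\nabla^g_XY$, and $\overline{\nabla}$ for the conjugate connection, defined by $Xg(Y,Z)=g(\nabla_XY,Z)+g(Y,\overline{\nabla}_XZ)$. It is trace-free if $\mathrm{tr}_gK=\sum_iK(e_i,e_i)=0$ ($\{e_i\}$ a $g$-orthonormal frame). The curvature of a connection $\nabla$ is $R(X,Y)Z=\nabla_X\nabla_YZ-\nabla_Y\nabla_XZ-\nabla_{[X,Y]}Z$, and its Ricci tensor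 is $\operatorname{Ric}(Y,Z)=\mathrm{tr}\{X\mapsto R(X,Y)Z\}$. The curvature interchange tensor field $L$ is defined by $g(L(Z,W)X,Y)=g(R(X,Y)Z,W)$. Superscripts $M$, $N$ indicate the tensors of $(M,g,\nabla^M)$, $(N,h,\nabla^N)$; $\operatorname{Ric}^N$, $\overline{\operatorname{Ric}}^N$, $\operatorname{Ric}^h$ are the Ricci tensors of $\nabla^N$, of its conjugate $\overline{\nabla}^N$, and of the Levi-Civita connection of $h$. The statistical structure induced by an immersion $u:M\to N$ from $(h,\nabla^N)$ is $g=u^*h$ and $\nabla^M$ determined by $g(\nabla^M_XY,Z)=h(\nabla^N_Xu_*Y,u_*Z)$ for $X,Y,Z\in\Gamma(TM)$. For a smooth map $u:M\to N$, let $\nabla^u$, $\overline{\nabla}^u$ be the connections on $u^{-1}TN$ induced by $u$ from $\nabla^N$ and $\overline{\nabla}^N$. With $\{e_i\}_{i=1,\dots,m}$ a local $g$-orthonormal frame of $M$, put $$\tau(u)=\sum_{i=1}^m\left(\nabla^u_{e_i}(u_*e_i)-u_*\nabla^M_{e_i}e_i\right),\qquad \bar{\Delta}^u\xi=\sum_{i=1}^m\left(\overline{\nabla}^u_{e_i}\overline{\nabla}^u_{e_i}\xi-\overline{\nabla}^u_{\overline{\nabla}^M_{e_i}e_i}\xi\right),$$ $$\tau_2(u)=\bar{\Delta}^u\tau(u)+\operatorname{div}^g(\mathrm{tr}_gK^M)\,\tau(u)-\sum_{i=1}^mL^N(u_*e_i,\tau(u))u_*e_i-K^N(\tau(u),\tau(u)),$$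 where $\operatorname{div}^gX=\mathrm{tr}(\nabla^gX)$. The map $u$ is statistical biharmonic if $\tau_2(u)=0$ identically. *)

(* Defs.v *)
From HB Require Import structures.
From mathcomp Require Import all_boot all_order all_algebra.
From mathcomp Require Import all_classical all_reals all_analysis.

Set Implicit Arguments.
Unset Strict Implicit.
Unset Printing Implicit Defensive.

Import Order.TTheory GRing.Theory Num.Theory.
Import numFieldNormedType.Exports.

Local Open Scope classical_set_scope.
Local Open Scope ring_scope.

(** * Smooth maps between open subsets of Euclidean spaces *)

(* Only used for [U] open; then ['D_v f] on [U] depends only on [f] on [U]. *)
Fixpoint Ck_on (R : realType) (V W : normedModType R) (k : nat) (U : set V)
    (f : V -> W) : Prop :=
  match k with
  | 0%N => forall x, U x -> {for x, continuous f}
  | k'.+1 => (forall x, U x -> differentiable f x) /\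
             (forall v, Ck_on k' U (fun x => 'D_v f x))
  end.

Definition smooth_on (R : realType) (V W : normedModType R) (U : set V)
    (f : V -> W) : Prop := forall k, Ck_on k U f.

(** * Smooth manifolds *)

(* Charts are total functions; [chart a] and its inverse [param a] are only
   meaningful on [dom a] and on [chart a @` dom a] respectively. *)
Record manifold (R : realType) (n : nat) := Manifold {
  carrier :> topologicalType ;
  atlas : Type ;
  dom : atlas -> set carrier ;
  chart : atlas -> carrier -> 'rV[R]_n ;
  param : atlas -> 'rV[R]_n -> carrier ;
  manifold_hausdorff : hausdorff_space carrier ;
  manifold_second_countable : @second_countable carrier ;
  dom_open : forall a, open (dom a) ;
  dom_cover : forall p, exists a, dom a p ;
  chart_im_open : forall a, open (chart a @` dom a) ;
  chartK : forall a p, dom a p -> param a (chart a p) = p ;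
  chart_continuous : forall a p, dom a p -> {for p, continuous (chart a)} ;
  param_continuous : forall a x, (chart a @` dom a) x ->
    {for x, continuous (param a)} ;
  chart_compatible : forall a b,
    smooth_on (chart a @` (dom a `&` dom b)) (chart b \o param a) }.

Arguments dom {R n M} : rename.
Arguments chart {R n M} : rename.
Arguments param {R n M} : rename.

Definition chart_im (R : realType) (n : nat) (M : manifold R n)
    (a : atlas M) : set 'rV[R]_n := chart a @` dom a.

Definition trans (R : realType) (n : nat) (M : manifold R n)
    (a b : atlas M) : 'rV[R]_n -> 'rV[R]_n := chart b \o param a.

(* Image in the chart [a] of an open subset of [dom a]. *)
Definition chart_open (R : realType) (n : nat) (M : manifold R n)
    (a : atlas M) (W : set 'rV[R]_n) : Prop :=
  open W /\ W `<=` chart_im a.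

(** * Metrics and connections

   Tensors and connections are given by their expressions in all the charts,
   subject to the usual transformation laws.  A vector field over the part
   [W] of the chart [a] is its component function ['rV_n -> 'rV_n]. *)

Record metric (R : realType) (n : nat) (M : manifold R n) := Metric {
  met :> atlas M -> 'rV[R]_n -> 'rV[R]_n -> 'rV[R]_n -> R ;
  met_scalar : forall a x v, chart_im a x -> scalar (met a x v) ;
  met_sym : forall a x v w, chart_im a x -> met a x v w = met a x w v ;
  met_pos : forall a x v, chart_im a x -> v != 0 -> 0 < met a x v v ;
  met_smooth : forall a v w, smooth_on (chart_im a) (fun x => met a x v w) ;
  met_trans : forall a b x v w, (chart a @` (dom a `&` dom b)) x ->
    met a x v w =
    met b (trans a b x) ('D_v (trans a b) x) ('D_w (trans a b) x) }.

(* [chr a x v w] is the Christoffel term Gamma^k_ij v^i w^j; the last law says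
   that the push-forward of nabla_v w by a transition map is the covariant
   derivative of the push-forwards. *)
Record connection (R : realType) (n : nat) (M : manifold R n) := Connection {
  chr :> atlas M -> 'rV[R]_n -> 'rV[R]_n -> 'rV[R]_n -> 'rV[R]_n ;
  chr_linearl : forall a x w, chart_im a x -> linear (fun v => chr a x v w) ;
  chr_linearr : forall a x v, chart_im a x -> linear (chr a x v) ;
  chr_smooth : forall a v w, smooth_on (chart_im a) (fun x => chr a x v w) ;
  chr_trans : forall a b x v w, (chart a @` (dom a `&` dom b)) x ->
    'D_(chr a x v w) (trans a b) x =
    'D_v (fun z => 'D_w (trans a b) z) x
    + chr b (trans a b x) ('D_v (trans a b) x) ('D_w (trans a b) x) }.

Definition cov (R : realType) (n : nat) (M : manifold R n)
    (D : connection M) (a : atlas M) (X Y : 'rV[R]_n -> 'rV[R]_n)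
    (x : 'rV[R]_n) : 'rV[R]_n :=
  'D_(X x) Y x + D a x (X x) (Y x).

Definition bracket (R : realType) (n : nat) (X Y : 'rV[R]_n -> 'rV[R]_n)
    (x : 'rV[R]_n) : 'rV[R]_n := 'D_(X x) Y x - 'D_(Y x) X x.

(* X g(Y, Z) *)
Definition deriv_met (R : realType) (n : nat) (M : manifold R n)
    (g : metric M) (a : atlas M) (X Y Z : 'rV[R]_n -> 'rV[R]_n)
    (x : 'rV[R]_n) : R := 'D_(X x) (fun z => g a z (Y z) (Z z)) x.

(* (nabla_X g)(Y, Z) *)
Definition cov_met (R : realType) (n : nat) (M : manifold R n)
    (D : connection M) (g : metric M) (a : atlas M)
    (X Y Z : 'rV[R]_n -> 'rV[R]_n) (x : 'rV[R]_n) : R :=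
  deriv_met g a X Y Z x
  - g a x (cov D a X Y x) (Z x) - g a x (Y x) (cov D a X Z x).

Definition torsion_free (R : realType) (n : nat) (M : manifold R n)
    (D : connection M) : Prop :=
  forall a W X Y, chart_open a W -> smooth_on W X -> smooth_on W Y ->
  forall x, W x -> cov D a X Y x - cov D a Y X x = bracket X Y x.

Definition is_levi_civita (R : realType) (n : nat) (M : manifold R n)
    (g : metric M) (D : connection M) : Prop :=
  torsion_free D /\
  forall a W X Y Z, chart_open a W ->
    smooth_on W X -> smooth_on W Y -> smooth_on W Z ->
  forall x, W x -> cov_met D g a X Y Z x = 0.

Definition is_codazzi (R : realType) (n : nat) (M : manifold R n)
    (g : metric M) (D : connection M) : Prop :=
  forall a W X Y Z, chart_open a W ->
    smooth_on W X -> smooth_on W Y -> smooth_on W Z ->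
  forall x, W x -> cov_met D g a X Y Z x = cov_met D g a Y X Z x.

Definition is_conjugate (R : realType) (n : nat) (M : manifold R n)
    (g : metric M) (D Dbar : connection M) : Prop :=
  forall a W X Y Z, chart_open a W ->
    smooth_on W X -> smooth_on W Y -> smooth_on W Z ->
  forall x, W x ->
    deriv_met g a X Y Z x =
    g a x (cov D a X Y x) (Z x) + g a x (Y x) (cov Dbar a X Z x).

(* The conjugate and Levi-Civita connections are uniquely determined by
   [smet] and [nabla]; they are carried along only to have names. *)
Record statistical_structure (R : realType) (n : nat) (M : manifold R n) :=
  StatisticalStructure {
  smet : metric M ;
  nabla : connection M ;
  nabla_torsion_free : torsion_free nabla ;
  nabla_codazzi : is_codazzi smet nabla ;
  nablabar : connection M ;
  nablabarP : is_conjugate smet nabla nablabar ;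
  nablag : connection M ;
  nablagP : is_levi_civita smet nablag }.

(** * Tensors

   Each operator below is tensorial in its arguments: its value on vectors is
   taken on the fields with constant components in the chart. *)

Definition diff_field (R : realType) (n : nat) (M : manifold R n)
    (S : statistical_structure M) (a : atlas M)
    (X Y : 'rV[R]_n -> 'rV[R]_n) (x : 'rV[R]_n) : 'rV[R]_n :=
  cov (nabla S) a X Y x - cov (nablag S) a X Y x.

Definition diff_tensor (R : realType) (n : nat) (M : manifold R n)
    (S : statistical_structure M) (a : atlas M) (x v w : 'rV[R]_n)
    : 'rV[R]_n := diff_field S a (cst v) (cst w) x.

Definition curv_field (R : realType) (n : nat) (M : manifold R n)
    (D : connection M) (a : atlas M) (X Y Z : 'rV[R]_n -> 'rV[R]_n)
    (x : 'rV[R]_n) : 'rV[R]_n :=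
  cov D a X (cov D a Y Z) x - cov D a Y (cov D a X Z) x
  - cov D a (bracket X Y) Z x.

Definition curv (R : realType) (n : nat) (M : manifold R n)
    (D : connection M) (a : atlas M) (x v w z : 'rV[R]_n) : 'rV[R]_n :=
  curv_field D a (cst v) (cst w) (cst z) x.

Definition Ric (R : realType) (n : nat) (M : manifold R n)
    (D : connection M) (a : atlas M) (x w z : 'rV[R]_n) : R :=
  \tr (lin1_mx (fun v => curv D a x v w z)).

(* [interchange S a x z w v] is L(z, w)v, the unique vector l such that
   g(l, y) = g(R(v, y)z, w) for all y. *)
Definition interchange (R : realType) (n : nat) (M : manifold R n)
    (S : statistical_structure M) (a : atlas M) (x z w v : 'rV[R]_n)
    : 'rV[R]_n :=
  xget 0 [set l | forall y,
    smet S a x l y = smet S a x (curv (nabla S) a x v y z) w].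

Definition divg (R : realType) (n : nat) (M : manifold R n)
    (S : statistical_structure M) (a : atlas M) (X : 'rV[R]_n -> 'rV[R]_n)
    (x : 'rV[R]_n) : R :=
  \tr (lin1_mx (fun v => cov (nablag S) a (cst v) X x)).

Definition orthonormal (R : realType) (n : nat) (M : manifold R n)
    (g : metric M) (a : atlas M) (x : 'rV[R]_n) (e : 'I_n -> 'rV[R]_n)
    : Prop := forall i j, g a x (e i) (e j) = (i == j)%:R.

Definition orthonormal_frame (R : realType) (n : nat) (M : manifold R n)
    (g : metric M) (a : atlas M) (W : set 'rV[R]_n)
    (e : 'I_n -> 'rV[R]_n -> 'rV[R]_n) : Prop :=
  (forall i, smooth_on W (e i)) /\
  (forall x, W x -> orthonormal g a x (e ^~ x)).

Definition trace_free (R : realType) (n : nat) (M : manifold R n)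
    (S : statistical_structure M) : Prop :=
  forall a x e, chart_im a x -> orthonormal (smet S) a x e ->
  \sum_(i < n) diff_tensor S a x (e i) (e i) = 0.

(** * Maps between manifolds *)

Definition rep_dom (R : realType) (m n : nat) (M : manifold R m)
    (N : manifold R n) (u : M -> N) (a : atlas M) (b : atlas N)
    : set 'rV[R]_m :=
  chart a @` (dom a `&` u @^-1` dom b).

Definition rep (R : realType) (m n : nat) (M : manifold R m)
    (N : manifold R n) (u : M -> N) (a : atlas M) (b : atlas N)
    : 'rV[R]_m -> 'rV[R]_n :=
  chart b \o u \o param a.

Definition smooth_map (R : realType) (m n : nat) (M : manifold R m)
    (N : manifold R n) (u : M -> N) : Prop :=
  continuous u /\ forall a b, smooth_on (rep_dom u a b) (rep u a b).

Definition immersion (R : realType) (m n : nat) (M : manifold R m)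
    (N : manifold R n) (u : M -> N) : Prop :=
  smooth_map u /\
  forall a b x v, rep_dom u a b x -> 'D_v (rep u a b) x = 0 -> v = 0.

(* Sections of u^{-1}TN: [sec b p] is the component vector of the value at [p]
   in the chart [b] around [u p]. *)
Record section_along (R : realType) (m n : nat) (M : manifold R m)
    (N : manifold R n) (u : M -> N) := SectionAlong {
  sec :> atlas N -> M -> 'rV[R]_n ;
  sec_trans : forall b b' p, dom b (u p) -> dom b' (u p) ->
    sec b' p = 'D_(sec b p) (trans b b') (chart b (u p)) ;
  sec_smooth : forall a b,
    smooth_on (rep_dom u a b) (fun x => sec b (param a x)) }.

(* u_* X, for X a vector field of M *)
Definition pushf (R : realType) (m n : nat) (M : manifold R m)
    (N : manifold R n) (u : M -> N) (a : atlas M) (b : atlas N)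
    (X : 'rV[R]_m -> 'rV[R]_m) (x : 'rV[R]_m) : 'rV[R]_n :=
  'D_(X x) (rep u a b) x.

(* The connection on u^{-1}TN induced by [D], applied to [xi] along [X]. *)
Definition cov_along (R : realType) (m n : nat) (M : manifold R m)
    (N : manifold R n) (u : M -> N) (D : connection N) (a : atlas M)
    (b : atlas N) (X : 'rV[R]_m -> 'rV[R]_m) (xi : 'rV[R]_m -> 'rV[R]_n)
    (x : 'rV[R]_m) : 'rV[R]_n :=
  'D_(X x) xi x + D b (rep u a b x) (pushf u a b X x) (xi x).

Definition induced_structure (R : realType) (m n : nat) (M : manifold R m)
    (N : manifold R n) (SM : statistical_structure M)
    (SN : statistical_structure N) (u : M -> N) : Prop :=
  (forall a b x v w, rep_dom u a b x ->
    smet SM a x v w =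
    smet SN b (rep u a b x) ('D_v (rep u a b) x) ('D_w (rep u a b) x)) /\
  (forall a b W X Y Z, open W -> W `<=` rep_dom u a b ->
    smooth_on W X -> smooth_on W Y -> smooth_on W Z ->
   forall x, W x ->
    smet SM a x (cov (nabla SM) a X Y x) (Z x) =
    smet SN b (rep u a b x)
      (cov_along u (nabla SN) a b X (pushf u a b Y) x) (pushf u a b Z x)).

Definition statistical_hypersurface (R : realType) (m n : nat)
    (M : manifold R m) (N : manifold R n) (SM : statistical_structure M)
    (SN : statistical_structure N) (u : M -> N) : Prop :=
  [/\ immersion u, induced_structure SM SN u & n = m.+1].

(** * Tension and bitension fields *)

Definition tension_in_frame (R : realType) (m n : nat) (M : manifold R m)
    (N : manifold R n) (SM : statistical_structure M)
    (SN : statistical_structure N) (u : M -> N) (a : atlas M) (b : atlas N)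
    (e : 'I_m -> 'rV[R]_m -> 'rV[R]_m) (x : 'rV[R]_m) : 'rV[R]_n :=
  \sum_(i < m) (cov_along u (nabla SN) a b (e i) (pushf u a b (e i)) x
                - pushf u a b (cov (nabla SM) a (e i) (e i)) x).

Definition is_tension_field (R : realType) (m n : nat) (M : manifold R m)
    (N : manifold R n) (SM : statistical_structure M)
    (SN : statistical_structure N) (u : M -> N) (tau : section_along u)
    : Prop :=
  forall a b W e, open W -> W `<=` rep_dom u a b ->
    orthonormal_frame (smet SM) a W e ->
  forall x, W x -> tau b (param a x) = tension_in_frame SM SN u a b e x.

Definition laplace_bar (R : realType) (m n : nat) (M : manifold R m)
    (N : manifold R n) (SM : statistical_structure M)
    (SN : statistical_structure N) (u : M -> N) (a : atlas M) (b : atlas N)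
    (e : 'I_m -> 'rV[R]_m -> 'rV[R]_m) (xi : 'rV[R]_m -> 'rV[R]_n)
    (x : 'rV[R]_m) : 'rV[R]_n :=
  \sum_(i < m)
    (cov_along u (nablabar SN) a b (e i)
       (cov_along u (nablabar SN) a b (e i) xi) x
     - cov_along u (nablabar SN) a b
         (cov (nablabar SM) a (e i) (e i)) xi x).

Definition tr_diff (R : realType) (m : nat) (M : manifold R m)
    (SM : statistical_structure M) (a : atlas M)
    (e : 'I_m -> 'rV[R]_m -> 'rV[R]_m) (x : 'rV[R]_m) : 'rV[R]_m :=
  \sum_(i < m) diff_field SM a (e i) (e i) x.

Definition bitension_in_frame (R : realType) (m n : nat) (M : manifold R m)
    (N : manifold R n) (SM : statistical_structure M)
    (SN : statistical_structure N) (u : M -> N) (a : atlas M) (b : atlas N)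
    (e : 'I_m -> 'rV[R]_m -> 'rV[R]_m) (tau : 'rV[R]_m -> 'rV[R]_n)
    (x : 'rV[R]_m) : 'rV[R]_n :=
  laplace_bar SM SN u a b e tau x
  + divg SM a (tr_diff SM a e) x *: tau x
  - \sum_(i < m) interchange SN b (rep u a b x)
      (pushf u a b (e i) x) (tau x) (pushf u a b (e i) x)
  - diff_tensor SN b (rep u a b x) (tau x) (tau x).

Definition statistical_biharmonic (R : realType) (m n : nat)
    (M : manifold R m) (N : manifold R n) (SM : statistical_structure M)
    (SN : statistical_structure N) (u : M -> N) : Prop :=
  smooth_map u /\
  forall tau : section_along u, is_tension_field SM SN tau ->
  forall a b W e, open W -> W `<=` rep_dom u a b ->
    orthonormal_frame (smet SM) a W e ->
  forall x, W x ->
    bitension_in_frame SM SN u a b e (fun z => tau b (param a z)) x = 0.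

(* Main.v *)
Require Import Defs.
From HB Require Import structures.
From mathcomp Require Import all_boot all_order all_algebra.
From mathcomp Require Import all_classical all_reals all_analysis.
From mathcomp Require Import ring lra.

Set Implicit Arguments.
Unset Strict Implicit.
Unset Printing Implicit Defensive.

Import Order.TTheory GRing.Theory Num.Theory.
Import numFieldNormedType.Exports.

Local Open Scope classical_set_scope.
Local Open Scope ring_scope.

(** The proof is a Bochner argument at one point. Write [h] for the metric of
    [N], [xi] for the tension field, [e_i] for an orthonormal frame of [M],
    [T_i] for its image under [u_*], [nabla] and [nablabar] for the connection
    of [N] and its conjugate, [K] for the difference of [nabla] with the
    Levi-Civita connection. Suppose that [xi] is nonzero somewhere; its norm
    being constant, it is nonzero everywhere.

    Because the structure of [M] is induced, [xi] is the trace of the normal part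
    of [nabla_{e_i} T_j], hence normal ([tension_normal]). With [K(xi, xi) = 0]
    and [|xi|] constant, [nabla xi] and [nablabar xi] have no component along
    [xi] ([cov_xi_normal]): as [M] is a hypersurface they are tangential, with
    components [2 kappa_ij - B_ij] and [- B_ij] on [T_j], where
    [B_ij = h(nabla_{e_i} T_j, xi)] and [kappa_ij = h(K(T_i, xi), T_j)]. So the
    inner product of the Laplacian with [xi] is
    [- sum_ij B_ij (B_ij - 2 kappa_ij)] ([laplace_normal], [cov_xi_inner]).
    Trace-freeness of [N] and [K(xi, xi) = 0] make the trace of [K] over the
    tangent space of [M] vanish; the cubic forms of [M] and [N] correspond under
    [u_*] ([diff_tensor_pullback]), so [tr_g K^M = 0] and the divergence term
    disappears ([divg_tr_diff_eq0]). The curvatures of conjugate connections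
    being adjoint up to sign, the interchange term is the Ricci tensor of
    [nablabar] at [xi] ([interchange_trace]). Taking the inner product of the
    bitension field with [xi] thus gives

      [0 = - sum_ij B_ij (B_ij - 2 kappa_ij) + Ricbar(xi, xi)].

    In a trace-free structure [Ric + Ricbar - 2 Ric^h] at [xi] equals
    [- 2 |K(xi, _)|^2 = - 2 sum_ij kappa_ij^2] ([Ric_sum], [K_xi_normsq]), so the
    curvature assumption says [Ricbar(xi, xi) <= - sum_ij kappa_ij^2], and the
    identity above becomes [sum_ij (B_ij - kappa_ij)^2 <= 0]. Therefore
    [B = kappa]; but the trace of [B] is [|xi|^2] and that of [kappa] is [0], a
    contradiction ([bitension_neq0]).

    Everything happens in one chart of [M] and one of [N]. The supporting
    calculus is: smoothness of Gram-Schmidt orthonormalization, which provides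
    the frame; the symmetry of second derivatives, on which the adjointness of
    the curvatures rests; and the product rule for the metric along [u]. *)

(** * Differential calculus *)

Section Calculus.
Context {R : realType}.
Implicit Types V W : normedModType R.

Lemma scale_bilinear_for W :
  bilinear_for (GRing.Scale.Law.clone _ _ *:%R _)
    (GRing.Scale.Law.clone _ _ *:%R _) (fun (k : R) (w : W) => k *: w).
Proof.
split=> [w|k] a x y /=; first by rewrite scalerDl scalerA.
by rewrite scalerDr !scalerA mulrC.
Qed.

(** Smoothness is only assumed on open sets, so differentiability has to be
    transported between functions that agree near a point. *)
Lemma near_differentiable V W (f g : V -> W) x :
  (\near x, f x = g x) -> differentiable f x -> differentiable g x.
Proof.
move=> fg df.
have gE : g \o shift x = cst (g x) + 'd f x +o_ 0 id.
  apply/eqaddoP => e e0.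
  have /diff_locally/eqaddoP/(_ e e0) := df.
  apply: filter_app.
  have fg' : \forall h \near 0, f (h + x) = g (h + x).
    by move: fg; rewrite (near_shift 0) subr0.
  near=> h => /=; rewrite !fctE /=.
  by rewrite (near fg' h)// (nbhs_singleton fg).
have dg : 'd g x = 'd f x :> (V -> W).
  by apply: diff_unique gE; exact: diff_continuous.
apply/diff_locallyP; rewrite dg; split => //; exact: diff_continuous.
Unshelve. all: by end_near. Qed.

(** Leibniz rule: scaling is a continuous bilinear map. *)
Lemma scale_is_diff V W (k dk : V -> R) (f df : V -> W) x :
  is_diff x k dk -> is_diff x f df ->
  is_diff x (fun z => k z *: f z) (fun y => k x *: df y + dk y *: f x).
Proof.
move=> dkx dfx.
pose sM := bilinear_isBilinear.Build R R W W _ _ _ (scale_bilinear_for W).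
pose s : {bilinear R -> W -> W} := HB.pack (fun (k : R) (w : W) => k *: w) sM.
have sc : continuous (fun p : R * W => s p.1 p.2) by exact: scale_continuous.
have ds (p : R * W) : is_diff p (fun q => s q.1 q.2)
    (fun q => s p.1 q.2 + s q.1 p.2).
  by apply: DiffDef; [exact: differentiable_bilin|exact: diff_bilin].
have := @is_diff_comp _ _ _ _ (fun y => (k y, f y)) _ _ _ x
  (is_diff_pair dkx dfx) (ds _).
exact.
Qed.

Lemma differentiable_scale V W (k : V -> R) (f : V -> W) x :
  differentiable k x -> differentiable f x ->
  differentiable (fun z => k z *: f z) x.
Proof.
by move=> /differentiableP dk /differentiableP df; have [] := scale_is_diff dk df.
Qed.

Lemma derive_scale V W (k : V -> R) (f : V -> W) x v :
  differentiable k x -> differentiable f x ->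
  'D_v (fun z => k z *: f z) x = k x *: 'D_v f x + 'D_v k x *: f x.
Proof.
move=> dk df; rewrite !deriveE//; last exact: differentiable_scale.
have [_ E] := scale_is_diff (differentiableP dk) (differentiableP df).
by rewrite E.
Qed.

Lemma derive_comp (U V W : normedModType R) (f : U -> V) (g : V -> W) x v :
  differentiable f x -> differentiable g (f x) ->
  'D_v (g \o f) x = 'D_('D_v f x) g (f x).
Proof.
move=> df dg; rewrite !deriveE//; last exact: differentiable_comp.
by rewrite diff_comp.
Qed.

Lemma derive_linear V W (f : V -> W) x : differentiable f x ->
  linear (fun v => 'D_v f x).
Proof. by move=> df a v w; rewrite !deriveE// linearP. Qed.

End Calculus.

(** * Smooth functions *)

Section Smoothness.
Context {R : realType}.
Implicit Types V W : normedModType R.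

Lemma open_near (V : normedModType R) (U : set V) (P : V -> Prop) x :
  open U -> U x -> (forall z, U z -> P z) -> \forall z \near x, P z.
Proof.
by move=> oU Ux UP; apply: filterS UP _; exact: open_nbhs_nbhs.
Qed.

Lemma Ck_onS V W k (U : set V) (f : V -> W) : Ck_on k.+1 U f -> Ck_on k U f.
Proof.
elim: k f => [f [df _] x Ux|k IH f [df Df]].
  exact/differentiable_continuous/df.
by split=> // v; apply: IH; exact: Df.
Qed.

Lemma Ck_on_eq V W k (U : set V) (f g : V -> W) : open U ->
  (forall x, U x -> f x = g x) -> Ck_on k U f -> Ck_on k U g.
Proof.
move=> oU; elim: k f g => [f g fg cf x Ux|k IH f g fg [df Df]].
  have fgx : \forall z \near x, f z = g z by exact: open_near fg.
  rewrite /prop_for /continuous_at -fg//.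
  exact: cvg_trans (near_eq_cvg fgx) (cf x Ux).
have fgx x : U x -> \forall z \near x, f z = g z.
  by move=> Ux; exact: open_near fg.
split=> [x Ux|v]; first by apply: near_differentiable (df x Ux); exact: fgx.
by apply: IH (Df v) => x Ux; apply: near_eq_derive; exact: fgx.
Qed.

(** The inductive step of all the closure properties of [Ck_on] below. *)
Lemma Ck_on_succ V W k (U : set V) (f : V -> W) (Df : V -> V -> W) : open U ->
  (forall x, U x -> differentiable f x) ->
  (forall v x, U x -> 'D_v f x = Df v x) ->
  (forall v, Ck_on k U (Df v)) -> Ck_on k.+1 U f.
Proof.
move=> oU df DfE CDf; split=> // v.
by apply: Ck_on_eq (CDf v) => // x Ux; rewrite DfE.
Qed.

Lemma smooth_on_differentiable V W (U : set V) (f : V -> W) x :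
  smooth_on U f -> U x -> differentiable f x.
Proof. by move=> /(_ 1%N) [df _]; exact: df. Qed.

Lemma smooth_on_derive V W (U : set V) (f : V -> W) v :
  smooth_on U f -> smooth_on U (fun x => 'D_v f x).
Proof. by move=> sf k; have [_] := sf k.+1; apply. Qed.

Lemma smooth_on_sub V W (U U' : set V) (f : V -> W) :
  U' `<=` U -> smooth_on U f -> smooth_on U' f.
Proof.
move=> sub sf k; have {sf} := sf k.
elim: k f => [f cf x /sub|k IH f [df Df]]; first exact: cf.
by split=> [x /sub|v]; [exact: df|apply: IH; exact: Df].
Qed.

Lemma smooth_on_cst V W (U : set V) (c : W) : smooth_on U (cst c).
Proof.
move=> k; elim: k c => [c x _|k IH c]; first exact: cvg_cst.
split=> [x _|v]; first exact: differentiable_cst.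
rewrite (_ : (fun x => _) = cst 0)//; apply/funext => x; exact: derive_cst.
Qed.

Lemma Ck_onD V W k (U : set V) (f g : V -> W) : open U ->
  Ck_on k U f -> Ck_on k U g -> Ck_on k U (fun x => f x + g x).
Proof.
move=> oU; elim: k f g => [f g cf cg x Ux|k IH f g [df Df] [dg Dg]].
  by apply: cvgD; [exact: cf|exact: cg].
apply: (Ck_on_succ (Df := fun v x => 'D_v f x + 'D_v g x)) => //.
- by move=> x Ux; apply: differentiableD; [exact: df|exact: dg].
- by move=> v x Ux; apply: deriveD; apply: diff_derivable; [exact: df|exact: dg].
- by move=> v; apply: IH; [exact: Df|exact: Dg].
Qed.

Lemma Ck_onZ V W k (U : set V) (f : V -> R) (g : V -> W) : open U ->
  Ck_on k U f -> Ck_on k U g -> Ck_on k U (fun x => f x *: g x).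
Proof.
move=> oU; elim: k f g => [f g cf cg x Ux|k IH f g Cf Cg].
  by apply: cvgZ; [exact: cf|exact: cg].
have [[df Df] [dg Dg]] := (Cf, Cg).
apply: (Ck_on_succ (Df := fun v x => f x *: 'D_v g x + 'D_v f x *: g x)) => //.
- by move=> x Ux; apply: differentiable_scale; [exact: df|exact: dg].
- by move=> v x Ux; apply: derive_scale; [exact: df|exact: dg].
- move=> v; apply: Ck_onD => //; apply: IH;
    by [exact: Ck_onS|exact: Dg|exact: Df].
Qed.

Lemma smooth_onD V W (U : set V) (f g : V -> W) : open U ->
  smooth_on U f -> smooth_on U g -> smooth_on U (fun x => f x + g x).
Proof. by move=> oU sf sg k; exact: Ck_onD. Qed.

Lemma smooth_onZ V W (U : set V) (f : V -> R) (g : V -> W) : open U ->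
  smooth_on U f -> smooth_on U g -> smooth_on U (fun x => f x *: g x).
Proof. by move=> oU sf sg k; exact: Ck_onZ. Qed.

Lemma smooth_on_sum V W (U : set V) I (r : seq I) (f : I -> V -> W) : open U ->
  (forall i, smooth_on U (f i)) -> smooth_on U (fun x => \sum_(i <- r) f i x).
Proof.
move=> oU sf; elim: r => [|i r IH].
  rewrite (_ : (fun x => _) = cst 0); first exact: smooth_on_cst.
  by apply/funext => x; rewrite big_nil.
rewrite (_ : (fun x => _) = fun x => f i x + \sum_(j <- r) f j x).
  exact: smooth_onD.
by apply/funext => x; rewrite big_cons.
Qed.

(** The derivative of [q ^ (-1/2)] is [- 1/2 (q ^ (-1/2)) ^ 3] times the
    derivative of [q]: an expression with one less derivative in which only
    products occur, so that regularity follows by induction. *)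
Lemma smooth_on_rsqrt V (U : set V) (q : V -> R) : open U ->
  (forall x, U x -> 0 < q x) -> smooth_on U q ->
  smooth_on U (fun x => (Num.sqrt (q x))^-1).
Proof.
move=> oU q0 sq.
have ds (t : R) : 0 < t -> differentiable (@Num.sqrt R) t.
  by move=> t0; apply/derivable1_diffP; have [] := is_derive1_sqrt t0.
have dr x : U x -> differentiable (fun x => Num.sqrt (q x)) x.
  move=> Ux; apply: (@differentiable_comp _ _ _ _ q (@Num.sqrt R)).
    exact: smooth_on_differentiable Ux.
  exact/ds/q0.
have s0 x : U x -> Num.sqrt (q x) != 0.
  by move=> /q0; rewrite -sqrtr_gt0 => /gt_eqF->.
have dphi x : U x -> differentiable (fun x => (Num.sqrt (q x))^-1) x.
  by move=> Ux; apply: differentiableV; [exact: dr|exact: s0].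
elim=> [|k IH]; first by move=> x Ux; exact/differentiable_continuous/dphi.
pose phi x := (Num.sqrt (q x))^-1.
apply: (Ck_on_succ (Df := fun v x =>
  (- 2^-1) *: (phi x *: (phi x *: (phi x *: 'D_v q x))))) => //.
- move=> v x Ux; rewrite deriveV; [|exact: s0|exact/diff_derivable/dr].
  rewrite (@derive_comp _ _ _ _ q (@Num.sqrt R)); last 2 first.
    exact: smooth_on_differentiable Ux.
    exact/ds/q0.
  have -> : 'D_('D_v q x) Num.sqrt (q x) = 'D_v q x * (2 * Num.sqrt (q x))^-1.
    rewrite deriveE; last exact/ds/q0.
    rewrite -[X in 'd _ _ X]mulr1 -[_ * 1]/(_ *: 1) linearZ/= -deriveE; last exact/ds/q0.
    by have [_ ->] := is_derive1_sqrt (q0 _ Ux).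
  rewrite /phi -exprVn invfM /GRing.scale/=; ring.
- move=> v; apply: Ck_onZ => //; first exact: (@smooth_on_cst _ R).
  do 3 apply: Ck_onZ => //; exact: smooth_on_derive.
Qed.

End Smoothness.

(** * Symmetry of second derivatives *)

Section SecondDerivatives.
Context {R : realType} {V : normedModType R}.
Implicit Types (f : V -> R) (x v w : V) (U : set V).

(** The limit argument of the symmetry of second derivatives: two continuous
    functions that take a common value arbitrarily close to [x] agree at [x]. *)
Lemma eq_of_near_values (F G : V -> R) x :
  {for x, continuous F} -> {for x, continuous G} ->
  (forall d : R, 0 < d -> exists p q, [/\ ball x d p, ball x d q & F p = G q]) ->
  F x = G x.
Proof.
move=> cF cG FG.
apply/eqP; rewrite -subr_eq0 -normr_le0; apply/ler_addgt0Pl => e e0.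
have e20 : 0 < e / 2 by rewrite divr_gt0.
move/cvgrPdist_lt : cF => /(_ _ e20)/nbhs_ballP[d1 /= d10 cF].
move/cvgrPdist_lt : cG => /(_ _ e20)/nbhs_ballP[d2 /= d20 cG].
have [|p [q [bp bq E]]] := FG (Num.min d1 d2); first by rewrite lt_min d10 d20.
have Fp : `|F x - F p| < e / 2.
  by apply: cF; apply: le_ball bp; rewrite ge_min lexx.
have Gq : `|G x - G q| < e / 2.
  by apply: cG; apply: le_ball bq; rewrite ge_min lexx orbT.
rewrite addr0 -(subrKA (F p)).
rewrite (le_trans (ler_normD _ _))// [leRHS]splitr lerD//; first exact: ltW.
by rewrite E distrC ltW.
Qed.

Lemma mean_value_line f x v (h : R) : 0 < h ->
  (forall s, 0 <= s <= h -> differentiable f (x + s *: v)) ->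
  exists2 c, 0 <= c <= h & f (x + h *: v) - f x = 'D_v f (x + c *: v) * h.
Proof.
move=> h0 df; pose l (s : R) : V := x + s *: v.
have [dl Dl] : (forall s : R, differentiable l s) /\ forall s : R, 'D_1 l s = v.
  have dl s : is_diff s l (0 + ( *:%R ^~ v)).
    exact: is_diffD (is_diff_cst x s) (is_diff_scalel s v).
  split=> s; have [dls E] := dl s; first by [].
  by rewrite deriveE// E add0r scale1r.
have dfl (s : R) : 0 <= s <= h -> is_derive s 1 (f \o l) ('D_v f (l s)).
  move=> sh; apply: DeriveDef.
    by apply/diff_derivable/differentiable_comp; [exact: dl|exact: df].
  by rewrite derive_comp; [rewrite Dl|exact: dl|exact: df].
have sub (s : R) : s \in `]0, h[ -> 0 <= s <= h.
  by rewrite in_itv/= => /andP[/ltW-> /ltW->].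
have cl : {within `[0, h], continuous (f \o l)}.
  by apply: derivable_within_continuous => s; rewrite in_itv/= => /dfl[].
have [c c0h] := MVT h0 (fun s sh => dfl s (sub s sh)) cl.
by rewrite /l /= scale0r addr0 subr0 => E; exists c; [exact: sub|].
Qed.

(** Two applications of the mean value theorem, first to the increment of [f] in
    the direction [w], viewed as a function along [v], and then along [w]. *)
Lemma second_difference f U x v w (h : R) : open U -> smooth_on U f -> 0 < h ->
  (forall s t, 0 <= s <= h -> 0 <= t <= h -> U (x + s *: v + t *: w)) ->
  exists s t, [/\ 0 <= s <= h, 0 <= t <= h &
    f (x + h *: v + h *: w) - f (x + h *: v) - (f (x + h *: w) - f x) =
    'D_w (fun z => 'D_v f z) (x + s *: v + t *: w) * h * h].
Proof.
move=> oU sf h0 inU.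
have h01 : 0 <= h <= h by rewrite lexx ltW.
have h00 : 0 <= (0 : R) <= h by rewrite lexx ltW.
have inU0 s : 0 <= s <= h -> U (x + s *: v).
  by move=> sh; rewrite -[X in U X]addr0 -(scale0r w); exact: inU.
pose T (z : V) := z + h *: w.
have [dT DT] : (forall z, differentiable T z) /\ forall u z, 'D_u T z = u.
  have dT z : is_diff z T (id + 0).
    exact: is_diffD (is_diff_id z) (is_diff_cst (h *: w) z).
  split=> [z|u z]; have [dTz E] := dT z; first by [].
  by rewrite deriveE// E addr0.
have df s : 0 <= s <= h -> differentiable f (x + s *: v).
  by move=> /inU0; exact: smooth_on_differentiable.
have dfT s : 0 <= s <= h -> differentiable (f \o T) (x + s *: v).
  move=> sh; apply: differentiable_comp; first exact: dT.
  exact: smooth_on_differentiable (inU _ _ sh h01).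
have [s sh Es] := @mean_value_line (f \o T - f) x v h h0
  (fun s sh => differentiableB (dfT s sh) (df s sh)).
have [t th Et] := @mean_value_line (fun z => 'D_v f z) (x + s *: v) w h h0
  (fun t th => smooth_on_differentiable (smooth_on_derive v sf) (inU s t sh th)).
exists s, t; split=> //; rewrite -Et.
have <- : 'D_v (f \o T - f) (x + s *: v) =
    'D_v f (x + s *: v + h *: w) - 'D_v f (x + s *: v).
  rewrite deriveB; [|exact/diff_derivable/dfT|exact/diff_derivable/df].
  rewrite derive_comp; [by rewrite DT|exact: dT|].
  exact: smooth_on_differentiable (inU _ _ sh h01).
rewrite -Es /T !fctE/=; ring.
Qed.

(** Schwarz: both iterated derivatives are limits of the same second
    difference quotient. *)
Lemma derive_comm f U x v w : open U -> smooth_on U f -> U x ->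
  'D_v (fun z => 'D_w f z) x = 'D_w (fun z => 'D_v f z) x.
Proof.
move=> oU sf Ux; pose F z := 'D_v (fun z => 'D_w f z) z.
pose G z := 'D_w (fun z => 'D_v f z) z.
rewrite -[LHS]/(F x) -[RHS]/(G x).
have cF : {for x, continuous F}.
  by have := smooth_on_derive v (smooth_on_derive w sf); move/(_ 0%N x Ux).
have cG : {for x, continuous G}.
  by have := smooth_on_derive w (smooth_on_derive v sf); move/(_ 0%N x Ux).
apply: eq_of_near_values cF cG _ => d' d'0.
have /nbhs_ballP[d0 /= d00 dU] : \forall z \near x, U z by exact: open_nbhs_nbhs.
pose d := Num.min d0 d'; have d_gt0 : 0 < d by rewrite lt_min d00 d'0.
(* The parallelogram of sides [h v] and [h w] then lies in the ball. *)
pose h := d / (`|v| + `|w| + 1).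
have c0 : 0 < `|v| + `|w| + 1 by rewrite ltr_wpDl ?addr_ge0.
have h0 : 0 < h by rewrite divr_gt0.
have inb s t : 0 <= s <= h -> 0 <= t <= h -> ball x d (x + s *: v + t *: w).
  move=> /andP[s0 sh] /andP[t0 th].
  rewrite -ball_normE /ball_/= -addrA opprD addNKr normrN.
  apply: (le_lt_trans (ler_normD _ _)); rewrite !normrZ !ger0_norm//.
  apply: (@le_lt_trans _ _ (h * (`|v| + `|w|))).
    by rewrite mulrDr lerD// ler_wpM2r.
  by rewrite mulrAC -mulrA gtr_pMr// ltr_pdivrMr// mul1r ltrDl.
have inU s t : 0 <= s <= h -> 0 <= t <= h -> U (x + s *: v + t *: w).
  by move=> sh th; apply: dU; apply: le_ball (inb s t sh th); rewrite ge_min lexx.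
have inU' s t : 0 <= s <= h -> 0 <= t <= h -> U (x + s *: w + t *: v).
  by move=> sh th; rewrite addrAC; exact: inU.
have [s [t [sh th E]]] := second_difference oU sf h0 inU.
have [s' [t' [sh' th' E']]] := second_difference oU sf h0 inU'.
have bd z : ball x d z -> ball x d' z.
  by apply: le_ball; rewrite ge_min lexx orbT.
exists (x + s' *: w + t' *: v), (x + s *: v + t *: w); split.
- by rewrite addrAC; exact/bd/inb.
- exact/bd/inb.
have h_neq0 : h != 0 by rewrite gt_eqF.
apply: (mulIf h_neq0); apply: (mulIf h_neq0).
rewrite -[LHS]E' -[RHS]E (addrAC x (h *: w)); ring.
Qed.

End SecondDerivatives.

(** * Bilinear maps and smooth families of them *)

Section Bilinear.

(** Bilinearity as a property of a plain function: the metrics and the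
    Christoffel terms are bilinear only over points of the charts. *)
Definition bilin {R : realType} {U V W : lmodType R} (B : U -> V -> W) :=
  (forall v, linear (B^~ v)) /\ (forall u, linear (B u)).

Context {R : realType} {U V W : lmodType R}.
Implicit Types (f : U -> W) (B : U -> V -> W).

Lemma linD f x y : linear f -> f (x + y) = f x + f y.
Proof. by move=> /(_ 1 x y); rewrite !scale1r. Qed.

Lemma lin0 f : linear f -> f 0 = 0.
Proof. by move=> lf; apply: (addrI (f 0)); rewrite -linD// !addr0. Qed.

Lemma linZ f a x : linear f -> f (a *: x) = a *: f x.
Proof. by move=> lf; rewrite -[a *: x]addr0 lf lin0// addr0. Qed.

Lemma lin_sum I (r : seq I) (F : I -> U) f :
  linear f -> f (\sum_(i <- r) F i) = \sum_(i <- r) f (F i).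
Proof.
move=> lf; elim: r => [|i r IH]; first by rewrite !big_nil lin0.
by rewrite !big_cons linD// IH.
Qed.

Lemma linear_add f g : linear f -> linear g -> linear (fun x => f x + g x).
Proof. by move=> lf lg k x y; rewrite lf lg scalerDr addrACA. Qed.

Lemma linear_sub f g : linear f -> linear g -> linear (fun x => f x - g x).
Proof. by move=> lf lg k x y; rewrite lf lg scalerBr opprD addrACA. Qed.

End Bilinear.

Section BilinearRules.
Context {R : realType} {U V W : lmodType R} (B : U -> V -> W) (hB : bilin B).

Lemma bilinDl x y z : B (x + y) z = B x z + B y z.
Proof. exact: (linD _ _ (hB.1 z)). Qed.
Lemma bilinDr x y z : B x (y + z) = B x y + B x z.
Proof. exact: (linD _ _ (hB.2 x)). Qed.
Lemma bilinZl a x y : B (a *: x) y = a *: B x y.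
Proof. exact: (linZ _ _ (hB.1 y)). Qed.
Lemma bilinZr a x y : B x (a *: y) = a *: B x y.
Proof. exact: (linZ _ _ (hB.2 x)). Qed.
Lemma bilin0l y : B 0 y = 0.
Proof. exact: (lin0 (hB.1 y)). Qed.
Lemma bilin0r x : B x 0 = 0.
Proof. exact: (lin0 (hB.2 x)). Qed.
Lemma bilinNl x y : B (- x) y = - B x y.
Proof. by rewrite -scaleN1r bilinZl scaleN1r. Qed.
Lemma bilinNr x y : B x (- y) = - B x y.
Proof. by rewrite -scaleN1r bilinZr scaleN1r. Qed.
Lemma bilinBl x y z : B (x - y) z = B x z - B y z.
Proof. by rewrite bilinDl bilinNl. Qed.
Lemma bilinBr x y z : B x (y - z) = B x y - B x z.
Proof. by rewrite bilinDr bilinNr. Qed.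
Lemma bilin_suml I (r : seq I) (F : I -> U) y :
  B (\sum_(i <- r) F i) y = \sum_(i <- r) B (F i) y.
Proof. exact: (lin_sum _ _ (hB.1 y)). Qed.
Lemma bilin_sumr I (r : seq I) (F : I -> V) x :
  B x (\sum_(i <- r) F i) = \sum_(i <- r) B x (F i).
Proof. exact: (lin_sum _ _ (hB.2 x)). Qed.

End BilinearRules.

Section LinearFamilies.
Context {R : realType} {V W : normedModType R} {n : nat}.

Lemma derive_coord (f : V -> 'rV[R]_n) x v i : differentiable f x ->
  'D_v (fun z => f z 0 i) x = ('D_v f x) 0 i.
Proof. by move=> df; rewrite derive_mx ?mxE//; exact: diff_derivable. Qed.

Lemma differentiable_coordinate (f : V -> 'rV[R]_n) x i : differentiable f x ->
  differentiable (fun z => f z 0 i) x.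
Proof.
move=> df; apply: (@differentiable_comp _ _ _ _ f (fun N => N 0 i)) => //.
exact: differentiable_coord.
Qed.

Lemma linear_coordE (L : 'rV[R]_n -> W) (y : 'rV[R]_n) : linear L ->
  L y = \sum_(i < n) y 0 i *: L (delta_mx 0 i).
Proof.
move=> lL; rewrite {1}[y]row_sum_delta (lin_sum _ _ lL).
by apply: eq_bigr => i _; rewrite (linZ _ _ lL).
Qed.

(** Leibniz rule for a linear map that depends on the point, proved by expanding
    the argument in the canonical basis. *)
Lemma linear_family_is_diff (L : V -> 'rV[R]_n -> W) (f : V -> 'rV[R]_n) x :
  (\forall z \near x, linear (L z)) -> (forall a, differentiable (L^~ a) x) ->
  differentiable f x ->
  differentiable (fun z => L z (f z)) x /\
  forall v, 'D_v (fun z => L z (f z)) x =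
    'D_v (L^~ (f x)) x + L x ('D_v f x).
Proof.
move=> lL dL df; pose F i z := f z 0 i *: L z (delta_mx 0 i).
have lLx : linear (L x) by exact: nbhs_singleton lL.
have dF i : differentiable (F i) x.
  by apply: differentiable_scale; [exact: differentiable_coordinate|exact: dL].
have FE : \forall z \near x, (\sum_(i < n) F i) z = L z (f z).
  apply: filterS lL => z lLz; rewrite fct_sumE [RHS]linear_coordE//.
have dFs : differentiable (\sum_(i < n) F i) x by exact: differentiable_sum.
split=> [|v]; first exact: near_differentiable FE _.
rewrite -(near_eq_derive _ FE) derive_sum; last by move=> i; exact/diff_derivable.
have -> : 'D_v (L^~ (f x)) x =
    \sum_(i < n) f x 0 i *: 'D_v (L^~ (delta_mx 0 i)) x.
  pose G i z := f x 0 i *: L z (delta_mx 0 i).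
  have GE : \forall z \near x, (\sum_(i < n) G i) z = L z (f x).
    apply: filterS lL => z lLz; rewrite fct_sumE [RHS]linear_coordE//.
  have dG i : derivable (G i) x v.
    by apply: derivableZ; exact/diff_derivable/dL.
  rewrite -(near_eq_derive _ GE) derive_sum//; apply: eq_bigr => i _.
  by apply: deriveZ; exact/diff_derivable/dL.
rewrite [in RHS](linear_coordE ('D_v f x) lLx) -big_split/=.
apply: eq_bigr => i _; rewrite derive_scale//; last exact: differentiable_coordinate.
by rewrite derive_coord.
Qed.

End LinearFamilies.

Lemma bilinear_family_is_diff (R : realType) (V W : normedModType R) (n p : nat)
    (B : V -> 'rV[R]_n -> 'rV[R]_p -> W)
    (f : V -> 'rV[R]_n) (g : V -> 'rV[R]_p) x :
  (\forall z \near x, bilin (B z)) ->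
  (forall a c, differentiable (fun z => B z a c) x) ->
  differentiable f x -> differentiable g x ->
  differentiable (fun z => B z (f z) (g z)) x /\
  forall v, 'D_v (fun z => B z (f z) (g z)) x =
    'D_v (fun z => B z (f x) (g x)) x
    + B x ('D_v f x) (g x) + B x (f x) ('D_v g x).
Proof.
move=> lB dB df dg.
have lBr a : \forall z \near x, linear (B z a).
  by apply: filterS lB => z lBz; exact: lBz.2.
have lBl : \forall z \near x, linear (fun a => B z a (g z)).
  by apply: filterS lB => z lBz; exact: lBz.1.
have gP a := @linear_family_is_diff _ _ _ _ _ g x (lBr a) (dB a) dg.
have [d E] := linear_family_is_diff lBl (fun a => (gP a).1) df.
split=> // v; rewrite E; have [_ ->] := gP (f x).
by rewrite addrAC.
Qed.

(** * Orthonormal bases of an inner product *)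

Section InnerProduct.
Context {R : realType} {n : nat} (g : 'rV[R]_n -> 'rV[R]_n -> R).
Context (hg : bilin (g : _ -> _ -> R^o)) (g_sym : forall x y, g x y = g y x).
Context (E : 'I_n -> 'rV[R]_n) (hE : forall i j, g (E i) (E j) = (i == j)%:R).

(** With [G] the Gram matrix of [g], orthonormality says that the matrix of
    the [E i] has [G E^T] as a right inverse; it is then a left inverse. *)
Lemma orthonormal_expansion (y : 'rV[R]_n) : y = \sum_j g y (E j) *: E j.
Proof.
pose G : 'M[R]_n := \matrix_(k, l) g (delta_mx 0 k) (delta_mx 0 l).
pose P : 'M[R]_n := \matrix_(i, j) E i 0 j.
have GE (x z : 'rV[R]_n) : (x *m G *m z^T) 0 0 = g x z.
  have -> : g x z = \sum_l \sum_k x 0 k * g (delta_mx 0 k) (delta_mx 0 l) * z 0 l.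
    rewrite {1}(row_sum_delta z) (bilin_sumr hg); apply: eq_bigr => l _.
    rewrite (bilinZr hg) {1}(row_sum_delta x) (bilin_suml hg) scaler_sumr.
    by apply: eq_bigr => k _; rewrite (bilinZl hg) /GRing.scale/= mulrC.
  rewrite !mxE; apply: eq_bigr => l _; rewrite !mxE mulr_suml.
  by apply: eq_bigr => k _; rewrite !mxE.
have rowP i : row i P = E i by apply/rowP => j; rewrite !mxE.
have PE i (x : 'rV[R]_n) : (x *m (G *m P^T)) 0 i = g x (E i).
  rewrite -GE -rowP mulmxA !mxE; apply: eq_bigr => k _.
  by rewrite !mxE.
have P1 : P *m (G *m P^T) = 1%:M.
  apply/matrixP => i j; rewrite [RHS]mxE -hE -PE -rowP -row_mul.
  by rewrite [RHS]mxE.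
rewrite -[LHS]mulmx1 -(mulmx1C P1) mulmxA mulmx_sum_row.
by apply: eq_bigr => j _; rewrite PE rowP.
Qed.

Lemma parseval x y : g x y = \sum_j g x (E j) * g y (E j).
Proof.
rewrite {1}(orthonormal_expansion x) (bilin_suml hg); apply: eq_bigr => j _.
by rewrite (bilinZl hg) [g (E j) y]g_sym.
Qed.

Lemma trace_orthonormal (f : 'rV[R]_n -> 'rV[R]_n) : linear f ->
  \tr (lin1_mx f) = \sum_j g (f (E j)) (E j).
Proof.
move=> lf; rewrite /mxtrace.
transitivity (\sum_i \sum_j g (delta_mx 0 i) (E j) * f (E j) 0 i).
  apply: eq_bigr => i _; rewrite mxE [in LHS](orthonormal_expansion (delta_mx 0 i)).
  rewrite (lin_sum _ _ lf) summxE; apply: eq_bigr => j _.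
  by rewrite (linZ _ _ lf) mxE.
rewrite exchange_big; apply: eq_bigr => j _.
rewrite [in RHS](row_sum_delta (f (E j))) (bilin_suml hg); apply: eq_bigr => i _.
by rewrite (bilinZl hg) /GRing.scale/= mulrC.
Qed.

(** This is what makes the interchange tensor, defined by duality, exist. *)
Lemma riesz_representation (phi : 'rV[R]_n -> R^o) : linear phi ->
  exists l, forall y, g l y = phi y.
Proof.
move=> lphi; exists (\sum_j phi (E j) *: E j) => y.
rewrite [in RHS](orthonormal_expansion y) (lin_sum _ _ lphi) (bilin_suml hg).
apply: eq_bigr => j _.
by rewrite (bilinZl hg) (linZ _ _ lphi) /GRing.scale/= g_sym mulrC.
Qed.

End InnerProduct.

(** * Connections and curvature in a chart *)

Section ConstantFields.
Context {R : realType} {n : nat} {M : manifold R n}.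
Implicit Types (g : metric M) (D : connection M) (a : atlas M).
Implicit Types (x v w z : 'rV[R]_n).

Lemma open_chart_im a : open (chart_im a).
Proof. exact: chart_im_open. Qed.

Lemma chart_open_im a : chart_open a (chart_im a).
Proof. by split; [exact: open_chart_im|]. Qed.

Lemma met_bilin g a x : chart_im a x -> bilin (g a x : _ -> _ -> R^o).
Proof.
move=> ax; have lr v : linear (g a x v : _ -> R^o) by exact: met_scalar.
split=> // v k y z.
by rewrite ![g a x _ v]met_sym//; exact: lr.
Qed.

Lemma chr_bilin D a x : chart_im a x -> bilin (D a x).
Proof. by move=> ax; split=> v; [exact: chr_linearl|exact: chr_linearr]. Qed.

Lemma met_nondegenerate g a x y : chart_im a x ->
  (forall z, g a x z y = 0) -> y = 0.
Proof.
move=> ax gy0; apply/eqP/negPn/negP => y0.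
by have := met_pos g ax y0; rewrite gy0 ltxx.
Qed.

Lemma cov_cst D a v w x : cov D a (cst v) (cst w) x = D a x v w.
Proof. by rewrite /cov derive_cst add0r. Qed.

Lemma near_chart_im a x : chart_im a x -> \forall y \near x, chart_im a y.
Proof. by move=> ax; apply: open_nbhs_nbhs; split=> //; exact: open_chart_im. Qed.

Lemma differentiable_met g a x (Y Z : 'rV[R]_n -> 'rV[R]_n) : chart_im a x ->
  differentiable Y x -> differentiable Z x ->
  differentiable (fun y => g a y (Y y) (Z y)) x.
Proof.
move=> ax dY dZ; have lg : \forall y \near x, bilin (g a y : _ -> _ -> R^o).
  by apply: filterS (near_chart_im ax) => y; exact: met_bilin.
have dg v w : differentiable (fun y => g a y v w : R^o) x.
  exact: smooth_on_differentiable (met_smooth g a v w) ax.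
by have [] := bilinear_family_is_diff lg dg dY dZ.
Qed.

Lemma chr_sym D a x v w : torsion_free D -> chart_im a x ->
  D a x v w = D a x w v.
Proof.
move=> tD ax; apply/eqP; rewrite -subr_eq0; apply/eqP.
have := tD _ _ _ _ (chart_open_im a) (@smooth_on_cst _ _ _ _ v)
  (@smooth_on_cst _ _ _ _ w) x ax.
by rewrite !cov_cst /bracket !derive_cst subrr.
Qed.

Lemma levi_civita_conjugate g D : is_levi_civita g D -> is_conjugate g D D.
Proof.
move=> [_ LC] a W X Y Z cW sX sY sZ x Wx; apply/eqP.
by rewrite -subr_eq0 opprD addrA; apply/eqP; exact: LC sX sY sZ x Wx.
Qed.

Lemma conjugate_chr g D Db a x v w z : is_conjugate g D Db -> chart_im a x ->
  'D_v (fun y => g a y w z) x = g a x (D a x v w) z + g a x w (Db a x v z).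
Proof.
move=> cD ax.
have := cD _ _ _ _ _ (chart_open_im a) (@smooth_on_cst _ _ _ _ v)
  (@smooth_on_cst _ _ _ _ w) (@smooth_on_cst _ _ _ _ z) x ax.
by rewrite !cov_cst.
Qed.

Lemma curv_cst D a x v w z : chart_im a x -> curv D a x v w z =
  cov D a (cst v) (fun y => D a y w z) x - cov D a (cst w) (fun y => D a y v z) x.
Proof.
move=> ax; rewrite /curv /curv_field.
have covE u : cov D a (cst u) (cst z) = fun y => D a y u z.
  by apply/funext => y; rewrite cov_cst.
have -> : bracket (cst v) (cst w) = cst 0.
  by apply/funext => y; rewrite /bracket !derive_cst subrr.
by rewrite !covE (bilin0l (chr_bilin D ax)) subr0.
Qed.

Lemma differentiable_chr D a x v w : chart_im a x ->
  differentiable (fun y => D a y v w) x.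
Proof. exact/smooth_on_differentiable/chr_smooth. Qed.

(** The fields in [curv] are constant, so its linearity is that of the
    Christoffel term, on a neighbourhood of [x], and of directional
    derivatives. *)
Lemma curv_linearr D a x v z : chart_im a x ->
  linear (fun w => curv D a x v w z).
Proof.
move=> ax; have hD := chr_bilin D ax.
rewrite (_ : (fun w => _) = fun w => cov D a (cst v) (fun y => D a y w z) x
    - cov D a (cst w) (fun y => D a y v z) x); last first.
  by apply/funext => w; rewrite curv_cst.
apply: linear_sub; apply: linear_add; last exact: hD.1.
- move=> k w1 w2.
  rewrite (@near_eq_derive _ _ _ _
    (fun y => k *: D a y w1 z + D a y w2 z)); last first.
    by apply: filterS (near_chart_im ax) => y ay; exact: (chr_bilin D ay).1.
  rewrite deriveD; [|apply: derivableZ|]; try exact/diff_derivable/differentiable_chr.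
  by rewrite deriveZ//; exact/diff_derivable/differentiable_chr.
- by move=> k w1 w2; rewrite (hD.1 z) (hD.2 v).
- exact: derive_linear (differentiable_chr _ _ _ ax).
Qed.

Lemma curv_antisym D a x v w z : chart_im a x ->
  curv D a x v w z = - curv D a x w v z.
Proof. by move=> ax; rewrite !curv_cst// opprB. Qed.

Lemma curv_diag D a x v z : chart_im a x -> curv D a x v v z = 0.
Proof. by move=> ax; rewrite curv_cst// subrr. Qed.

Lemma curv_linearl D a x w z : chart_im a x ->
  linear (fun v => curv D a x v w z).
Proof.
move=> ax k v1 v2; rewrite ![curv _ _ _ _ w _]curv_antisym//.
by rewrite (curv_linearr D w z ax) opprD scalerN.
Qed.

(** Differentiating [X (Y g(z, y)) = Y (X g(z, y))] by the product rule of
    conjugate connections, the mixed terms are symmetric and drop out. *)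
Lemma curv_conjugate g D Db a x v w z y : is_conjugate g D Db -> chart_im a x ->
  g a x (curv D a x v w z) y = - g a x z (curv Db a x v w y).
Proof.
move=> cD ax; have hg := met_bilin g ax.
have DD u1 u2 : 'D_u1 (fun p => 'D_u2 (fun q => g a q z y) p) x =
    g a x (cov D a (cst u1) (fun q => D a q u2 z) x) y
    + g a x (D a x u2 z) (Db a x u1 y) + (g a x (D a x u1 z) (Db a x u2 y)
    + g a x z (cov Db a (cst u1) (fun q => Db a q u2 y) x)).
  have smc (u : 'rV[R]_n) : smooth_on (chart_im a) (cst u) by exact: smooth_on_cst.
  have E1 := cD _ _ _ _ _ (chart_open_im a) (smc u1) (chr_smooth D a u2 z) (smc y)
    x ax.
  have E2 := cD _ _ _ _ _ (chart_open_im a) (smc u1) (smc z) (chr_smooth Db a u2 y)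
    x ax.
  rewrite !cov_cst in E1 E2; rewrite -E1 -E2 /deriv_met.
  rewrite (@near_eq_derive _ _ _ _ (fun q => g a q (D a q u2 z) y
      + g a q z (Db a q u2 y))); last first.
    by apply: filterS (near_chart_im ax) => q aq; exact: conjugate_chr.
  by rewrite deriveD//; apply/diff_derivable/differentiable_met => //;
    solve[exact: differentiable_chr|exact: differentiable_cst].
have := derive_comm v w (@open_chart_im a) (met_smooth g a z y) ax.
rewrite !DD !curv_cst// !(bilinBl hg) !(bilinBr hg) => E.
lra.
Qed.

End ConstantFields.

(** * The cubic form and the Ricci tensors of a statistical structure *)

Section StatisticalStructure.
Context {R : realType} {n : nat} {M : manifold R n} (S : statistical_structure M).
Implicit Types (a : atlas M) (x v w z y : 'rV[R]_n).

Lemma diff_tensorE a x v w :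
  diff_tensor S a x v w = nabla S a x v w - nablag S a x v w.
Proof. by rewrite /diff_tensor /diff_field !cov_cst. Qed.

Lemma diff_fieldE a X Y x : diff_field S a X Y x = diff_tensor S a x (X x) (Y x).
Proof. by rewrite diff_tensorE /diff_field /cov opprD addrACA subrr add0r. Qed.

Lemma diff_tensor_bilin a x : chart_im a x -> bilin (diff_tensor S a x).
Proof.
move=> ax; have [l r] := chr_bilin (nabla S) ax.
have [lg rg] := chr_bilin (nablag S) ax.
split=> v k y z; rewrite !diff_tensorE; first by rewrite l lg scalerBr opprD addrACA.
by rewrite r rg scalerBr opprD addrACA.
Qed.

Lemma diff_tensor_sym a x v w : chart_im a x ->
  diff_tensor S a x v w = diff_tensor S a x w v.
Proof.
move=> ax; rewrite !diff_tensorE (chr_sym _ _ (nabla_torsion_free S) ax).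
by rewrite (chr_sym _ _ (nablagP S).1 ax).
Qed.

(** The cubic form [g(K(v, w), z)] is, up to sign, half of the covariant
    derivative of the metric. *)
Lemma cov_met_cubic a x v w z : chart_im a x ->
  cov_met (nabla S) (smet S) a (cst v) (cst w) (cst z) x =
  - (smet S a x (diff_tensor S a x v w) z + smet S a x w (diff_tensor S a x v z)).
Proof.
move=> ax; have hg := met_bilin (smet S) ax.
rewrite /cov_met /deriv_met !cov_cst.
rewrite (conjugate_chr v w z (levi_civita_conjugate (nablagP S)) ax).
rewrite !diff_tensorE (bilinBl hg) (bilinBr hg); ring.
Qed.

(** Together with the symmetry of [K] this makes the cubic form totally
    symmetric. *)
Lemma diff_tensor_adjoint a x v w z : chart_im a x ->
  smet S a x (diff_tensor S a x v w) z = smet S a x w (diff_tensor S a x v z).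
Proof.
move=> ax; have sym := met_sym (smet S) _ _ ax.
have swap u1 u2 u3 : smet S a x u1 (diff_tensor S a x u2 u3) =
    smet S a x u2 (diff_tensor S a x u1 u3).
  have := @nabla_codazzi _ _ _ S _ _ _ _ _ (chart_open_im a) (@smooth_on_cst _ _ _ _ u2)
    (@smooth_on_cst _ _ _ _ u1) (@smooth_on_cst _ _ _ _ u3) x ax.
  rewrite !cov_met_cubic// (diff_tensor_sym u2 u1 ax) => /oppr_inj.
  by move/addrI.
rewrite sym (diff_tensor_sym v w ax) swap.
by rewrite (diff_tensor_sym z v ax).
Qed.

(** The Levi-Civita connection is its own conjugate; comparing both product
    rules and using the adjointness of [K] shows that conjugation is
    [nabla^g + K |-> nabla^g - K]. *)
Lemma nablabarE a x v w : chart_im a x ->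
  nablabar S a x v w = nablag S a x v w - diff_tensor S a x v w.
Proof.
move=> ax; have hg := met_bilin (smet S) ax; apply/eqP; rewrite -subr_eq0.
apply/eqP/(met_nondegenerate (g := smet S) ax) => z.
have E1 := conjugate_chr v z w (@nablabarP _ _ _ S) ax.
have E2 := conjugate_chr v z w (levi_civita_conjugate (nablagP S)) ax.
have := diff_tensor_adjoint v z w ax.
rewrite !diff_tensorE (bilinBl hg) !(bilinBr hg); rewrite E2 in E1; lra.
Qed.

Lemma conjugate_sum a x v w : chart_im a x ->
  nabla S a x v w + nablabar S a x v w = nablag S a x v w + nablag S a x v w.
Proof.
by move=> ax; rewrite nablabarE// diff_tensorE opprB addrCA [_ + (_ - _)]addrC subrK.
Qed.

Lemma nablabar_diff a x v w : chart_im a x ->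
  nablabar S a x v w = nabla S a x v w - diff_tensor S a x v w *+ 2.
Proof.
by move=> ax; rewrite nablabarE// !diff_tensorE mulr2n [in RHS]opprD addrA subKr.
Qed.

(** With [Gamma] and [Gammabar] the Christoffel terms of the connections of
    sum [2 Gamma^g] and difference [2 K], the derivatives and the terms linear
    in [K] cancel in the sum of the curvatures. *)
Lemma curv_sum a x v w z : chart_im a x ->
  let K := diff_tensor S a x in
  curv (nabla S) a x v w z + curv (nablabar S) a x v w z
    - curv (nablag S) a x v w z *+ 2
  = (K v (K w z) - K w (K v z)) *+ 2.
Proof.
move=> ax K; have hK : bilin K by exact: diff_tensor_bilin.
have hG := chr_bilin (nablag S) ax.
have bE u1 u2 : nablabar S a x u1 u2 = nablag S a x u1 u2 - K u1 u2.
  exact: nablabarE.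
have nE u1 u2 : nabla S a x u1 u2 = nablag S a x u1 u2 + K u1 u2.
  by rewrite /K diff_tensorE addrC subrK.
clearbody K.
have half u1 u2 : cov (nabla S) a (cst u1) (fun y => nabla S a y u2 z) x
    + cov (nablabar S) a (cst u1) (fun y => nablabar S a y u2 z) x
    - cov (nablag S) a (cst u1) (fun y => nablag S a y u2 z) x *+ 2
    = K u1 (K u2 z) *+ 2.
  have dE : 'D_u1 (fun y => nabla S a y u2 z) x
      + 'D_u1 (fun y => nablabar S a y u2 z) x
      = 'D_u1 (fun y => nablag S a y u2 z) x *+ 2.
    rewrite mulr2n -!deriveD; try exact/diff_derivable/differentiable_chr.
    by apply: near_eq_derive; apply: filterS (near_chart_im ax) => y ay;
      exact: conjugate_sum.
  rewrite /cov addrACA dE mulrnDl opprD addrACA subrr add0r !bE !nE.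
  rewrite !(bilinDr hG) !(bilinDr hK) !(bilinNr hG) !(bilinNr hK).
  move: (K _ _) (K _ _) (nablag _ _ _ _ _) (nablag _ _ _ _ _) => p q r s.
  by rewrite !mulr2n; apply/rowP => i; rewrite !mxE; lra.
rewrite !curv_cst// !mulrnBl -!half.
move: (cov _ _ _ _ _) (cov _ _ _ _ _) (cov _ _ _ _ _) (cov _ _ _ _ _)
  (cov _ _ _ _ _ *+ 2) (cov _ _ _ _ _ *+ 2) => c1 c2 c3 c4 c5 c6.
by apply/rowP => i; rewrite !mxE; lra.
Qed.

(** The orthonormal basis [e] only serves to show that the vector selected by
    the definition of the interchange tensor exists. *)
Lemma interchangeP a x e z w v y : chart_im a x -> Defs.orthonormal (smet S) a x e ->
  smet S a x (Defs.interchange S a x z w v) y =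
  smet S a x (curv (nabla S) a x v y z) w.
Proof.
move=> ax oe; have hg := met_bilin (smet S) ax.
pose phi y : R^o := smet S a x (curv (nabla S) a x v y z) w.
have lphi : linear phi.
  by move=> k y1 y2; rewrite /phi (curv_linearr (nabla S) v z ax) (hg.1 w).
have [l lP] := riesz_representation hg (fun _ _ => met_sym _ _ _ ax) oe lphi.
pose P : set 'rV[R]_n := [set l | forall y, smet S a x l y = phi y].
exact: (@xgetPex _ 0 P (ex_intro _ l lP)).
Qed.

Lemma Ric_orthonormal (D : connection M) a x e w z : chart_im a x ->
  Defs.orthonormal (smet S) a x e ->
  Ric D a x w z = \sum_j smet S a x (curv D a x (e j) w z) (e j).
Proof.
move=> ax oe; rewrite /Ric.
by rewrite (trace_orthonormal (met_bilin (smet S) ax) oe)//; exact: curv_linearl.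
Qed.

(** The trace of [K(X, K(v, v))] vanishes for a trace-free structure, and that
    of [K(v, K(X, v))] is the squared norm of the self-adjoint [K(v, _)]. *)
Lemma Ric_sum a x e v : trace_free S -> chart_im a x ->
  Defs.orthonormal (smet S) a x e ->
  Ric (nabla S) a x v v + Ric (nablabar S) a x v v - 2 * Ric (nablag S) a x v v
  = - 2 * \sum_j smet S a x (diff_tensor S a x v (e j)) (diff_tensor S a x v (e j)).
Proof.
move=> tS ax oe; have hg := met_bilin (smet S) ax.
rewrite !(Ric_orthonormal _ _ _ ax oe) -big_split/= !mulr_sumr -sumrB.
have trK : \sum_j smet S a x (diff_tensor S a x (e j) (e j))
    (diff_tensor S a x v v) = 0.
  by rewrite -(bilin_suml hg) tS// (bilin0l hg).
transitivity (2 * (\sum_j smet S a x (diff_tensor S a x (e j) (e j))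
    (diff_tensor S a x v v)) - 2 * \sum_j smet S a x (diff_tensor S a x v (e j))
    (diff_tensor S a x v (e j))); last by rewrite trK mulr0 sub0r -mulr_sumr mulNr.
rewrite !mulr_sumr -sumrB; apply: eq_bigr => j _.
have := curv_sum (e j) v v ax => /(congr1 (fun u => smet S a x u (e j))).
have adj := diff_tensor_adjoint _ _ _ ax.
have symK := diff_tensor_sym (e j) v ax; move: symK adj => /=.
move: (diff_tensor S a x) => K symK adj.
move: (curv _ _ _ _ _ _) (curv _ _ _ _ _ _) (curv _ _ _ _ _ _) => c1 c2 c3.
rewrite !mulr2n !(bilinDl hg, bilinNl hg) (adj (e j) (K v v)).
rewrite (adj v (K (e j) v)) symK [smet S a x (K v v) _](met_sym _ _ _ ax).
lra.
Qed.

End StatisticalStructure.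

(** * Smooth orthonormal frames *)

Section OrthonormalFrame.
Context {R : realType}.

Lemma smooth_on_coord (V : normedModType R) n (U : set V) (f : V -> 'rV[R]_n) i :
  open U -> smooth_on U f -> smooth_on U (fun x => f x 0 i).
Proof.
move=> oU sf k; have {sf} := sf k; elim: k f => [f cf x Ux|k IH f [df Df]].
  apply: (@continuous_comp _ _ _ f (fun N : 'rV[R]_n => N 0 i)); first exact: cf.
  exact: coord_continuous.
apply: (Ck_on_succ (Df := fun v x => ('D_v f x) 0 i)) => //.
- by move=> x Ux; apply: differentiable_coordinate; exact: df.
- by move=> v x Ux; apply: derive_coord; exact: df.
- by move=> v; apply: IH; exact: Df.
Qed.

Context {n : nat} {M : manifold R n} (g : metric M) (a : atlas M).
Implicit Types (W : set 'rV[R]_n) (Y Z : 'rV[R]_n -> 'rV[R]_n).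

(** Expand both fields in coordinates: only products and sums remain. *)
Lemma smooth_on_met W Y Z : open W -> W `<=` chart_im a ->
  smooth_on W Y -> smooth_on W Z -> smooth_on W (fun x => g a x (Y x) (Z x)).
Proof.
move=> oW Wa sY sZ k.
apply: (@Ck_on_eq _ _ _ _ _ (fun x => \sum_i \sum_j
  Y x 0 i *: (Z x 0 j *: g a x (delta_mx 0 i) (delta_mx 0 j)))) => //.
  move=> x /Wa ax; have hg := met_bilin g ax.
  rewrite [in RHS](row_sum_delta (Y x)) (bilin_suml hg); apply: eq_bigr => i _.
  rewrite (bilinZl hg) [in RHS](row_sum_delta (Z x)) (bilin_sumr hg) scaler_sumr.
  by apply: eq_bigr => j _; rewrite (bilinZr hg).
move: k; rewrite -/(smooth_on _ _); do 2 apply: smooth_on_sum => // ?.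
apply: smooth_onZ => //; first exact: smooth_on_coord.
apply: smooth_onZ => //; first exact: smooth_on_coord.
exact: smooth_on_sub (met_smooth g a _ _).
Qed.

(** Gram-Schmidt applied to the coordinate fields; the orthogonalized fields
    do not vanish since their leading coordinate is [1]. *)
Lemma gram_schmidt W k : open W -> W `<=` chart_im a -> (k <= n)%N ->
  exists e : nat -> 'rV[R]_n -> 'rV[R]_n, forall j, (j < k)%N ->
    [/\ smooth_on W (e j),
        forall x (l : 'I_n), (k <= l)%N -> e j x 0 l = 0 &
        forall i x, (i < k)%N -> W x -> g a x (e i x) (e j x) = (i == j)%:R].
Proof.
move=> oW Wa; elim: k => [_|k IH kn]; first by exists (fun _ _ => 0).
have [e eP] := IH (ltnW kn).
pose d : 'rV[R]_n := delta_mx 0 (Ordinal kn).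
pose w x := d - \sum_(j < k) g a x d (e j x) *: e j x.
have sw : smooth_on W w.
  apply: smooth_onD => //; first exact: smooth_on_cst.
  rewrite (_ : (fun x => _) =
      fun x => \sum_(j < k) (-1 : R) *: (g a x d (e j x) *: e j x)); last first.
    by apply/funext => x; rewrite -sumrN; apply: eq_bigr => j _; rewrite scaleN1r.
  apply: smooth_on_sum => // j; have [sj _ _] := eP j (ltn_ord j).
  apply: smooth_onZ => //; first exact: (@smooth_on_cst _ _ R).
  by apply: smooth_onZ => //; apply: smooth_on_met => //; exact: smooth_on_cst.
have w_neq0 x : w x != 0.
  apply/eqP => /rowP/(_ (Ordinal kn)); rewrite !mxE !eqxx summxE big1.
    by move/eqP; rewrite subr0 oner_eq0.
  move=> j _; have [_ ej0 _] := eP j (ltn_ord j).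
  by rewrite mxE ej0 ?mulr0.
have q0 x : W x -> 0 < g a x (w x) (w x) by move=> /Wa ax; exact: met_pos.
pose r x := (Num.sqrt (g a x (w x) (w x)))^-1.
have sr : smooth_on W r.
  by apply: smooth_on_rsqrt => //; exact: smooth_on_met.
have we j x : (j < k)%N -> W x -> g a x (w x) (e j x) = 0.
  move=> jk Wx; have hg := met_bilin g (Wa _ Wx).
  rewrite /w (bilinBl hg) (bilin_suml hg) (bigD1 (Ordinal jk))//= big1.
    have [_ _ ee] := eP j jk.
    by rewrite (bilinZl hg) ee// eqxx /GRing.scale/= mulr1 addr0 subrr.
  move=> i ij; have [_ _ ee] := eP j jk.
  rewrite (bilinZl hg) ee//; move: ij; rewrite -val_eqE/= => /negbTE->.
  exact: scaler0.
pose e' j x := if j == k then r x *: w x else e j x.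
exists e' => j; rewrite ltnS leq_eqVlt => jk.
have ee'k i x : (i < k)%N -> W x ->
    g a x (r x *: w x) (e i x) = 0 /\ g a x (e i x) (r x *: w x) = 0.
  move=> ik Wx; have ax := Wa _ Wx; have hg := met_bilin g ax.
  have E : g a x (r x *: w x) (e i x) = 0.
    by rewrite (bilinZl hg) we//; exact: scaler0.
  by split=> //; rewrite met_sym.
split.
- case/orP: jk => [/eqP->|jk]; rewrite /e'.
    by rewrite eqxx; exact: smooth_onZ.
  by rewrite (ltn_eqF jk); have [] := eP j jk.
- move=> x l kl; rewrite /e'; case: eqP jk => [_ _|_ /= jk].
    rewrite !mxE summxE big1 => [|i _].
      have /negbTE-> : l != Ordinal kn by rewrite -val_eqE/= gtn_eqF.
      by rewrite andbF subr0 mulr0.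
    by have [_ ei0 _] := eP i (ltn_ord i); rewrite mxE ei0 ?mulr0// ltnW.
  by have [_ -> //] := eP j jk; exact: ltnW.
- move=> i x; rewrite ltnS leq_eqVlt => ik Wx; rewrite /e'.
  have ax := Wa _ Wx; have hg := met_bilin g ax.
  have [ik'|ik'] := eqVneq i k; have [jk'|jk'] := eqVneq j k.
  + rewrite ik' jk' eqxx (bilinZl hg) (bilinZr hg) /r.
    set q := g a x _ _; have q0x : 0 < q := q0 _ Wx.
    rewrite /GRing.scale/= mulrA -expr2 exprVn sqr_sqrtr ?ltW//.
    by rewrite mulVf ?gt_eqF.
  + rewrite (negbTE jk') /= in jk; rewrite ik' eq_sym (negbTE jk').
    by have [] := ee'k j x jk Wx.
  + rewrite (negbTE ik') /= in ik; rewrite jk' (negbTE ik').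
    by have [] := ee'k i x ik Wx.
  + rewrite (negbTE ik') /= in ik; rewrite (negbTE jk') /= in jk.
    by have [_ _ ->] := eP j jk.
Qed.

Lemma orthonormal_frame_exists W : open W -> W `<=` chart_im a ->
  exists e, orthonormal_frame g a W e.
Proof.
move=> oW Wa; have [e eP] := gram_schmidt oW Wa (leqnn n).
exists (fun i => e i); split=> [i|x Wx i j]; first by have [] := eP i (ltn_ord i).
by have [_ _ ->] := eP j (ltn_ord j).
Qed.

End OrthonormalFrame.

(** * Calculus along a smooth map *)

Section AlongMap.
Context {R : realType} {m n : nat} {M : manifold R m} {N : manifold R n}.
Context (u : M -> N) (su : smooth_map u) (a : atlas M) (b : atlas N).
Implicit Types (x v w : 'rV[R]_m) (X Y : 'rV[R]_m -> 'rV[R]_m).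
Implicit Types (xi eta : 'rV[R]_m -> 'rV[R]_n) (D : connection N).

Lemma rep_dom_sub : rep_dom u a b `<=` chart_im a.
Proof. by move=> _ [p [ap _] <-]; exists p. Qed.

Lemma rep_chart_im x : rep_dom u a b x -> chart_im b (rep u a b x).
Proof.
by move=> [p [ap bp] <-]; exists (u p) => //; rewrite /rep /= chartK.
Qed.

(** Continuity of [u] makes the whole domain of the local expression of [u] a
    possible domain for frames. *)
Lemma rep_dom_open : open (rep_dom u a b).
Proof.
rewrite openE => x [p [ap bp] xE].
have ax : chart_im a x by exists p.
have pb : \forall y \near x, dom b (u (param a y)).
  have nb : nbhs (u (param a x)) (dom b).
    by apply: open_nbhs_nbhs; split; [exact: dom_open|rewrite -xE chartK].
  have cp : {for x, continuous (param a)} := param_continuous ax.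
  exact: (cp (u @^-1` dom b) (su.1 _ _ nb)).
apply: filterS (filterI (near_chart_im ax) pb) => y [[q aq <-]].
by rewrite chartK// => bq; exists q.
Qed.

Lemma near_rep_dom x : rep_dom u a b x -> \forall y \near x, rep_dom u a b y.
Proof. by move=> Wx; apply: open_nbhs_nbhs; split=> //; exact: rep_dom_open. Qed.

Lemma smooth_rep : smooth_on (rep_dom u a b) (rep u a b).
Proof. exact: su.2. Qed.

Lemma differentiable_derive_along (V : normedModType R) (f : 'rV[R]_m -> V) X x :
  smooth_on (rep_dom u a b) f -> rep_dom u a b x -> differentiable X x ->
  differentiable (fun z => 'D_(X z) f z) x.
Proof.
move=> sf Wx dX.
have lf : \forall z \near x, linear (fun v => 'D_v f z).
  apply: filterS (near_rep_dom Wx) => z Wz.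
  exact/derive_linear/(smooth_on_differentiable sf).
have df v : differentiable (fun z => 'D_v f z) x.
  exact: smooth_on_differentiable (smooth_on_derive v sf) Wx.
by have [] := linear_family_is_diff lf df dX.
Qed.

Lemma differentiable_pushf X x : rep_dom u a b x -> differentiable X x ->
  differentiable (pushf u a b X) x.
Proof. exact/differentiable_derive_along/smooth_rep. Qed.

Lemma differentiable_chr_along D xi eta x : rep_dom u a b x ->
  differentiable xi x -> differentiable eta x ->
  differentiable (fun z => D b (rep u a b z) (xi z) (eta z)) x.
Proof.
move=> Wx dxi deta.
have lD : \forall z \near x, bilin (D b (rep u a b z)).
  apply: filterS (near_rep_dom Wx) => z Wz; exact/chr_bilin/rep_chart_im.
have dD (v w : 'rV[R]_n) : differentiable (fun z => D b (rep u a b z) v w) x.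
  apply: (@differentiable_comp _ _ _ _ (rep u a b) (fun y => D b y v w)).
    exact: smooth_on_differentiable smooth_rep Wx.
  exact/differentiable_chr/rep_chart_im.
by have [] := bilinear_family_is_diff lD dD dxi deta.
Qed.

Lemma differentiable_cov_along D X xi x : rep_dom u a b x ->
  differentiable X x -> smooth_on (rep_dom u a b) xi ->
  differentiable (cov_along u D a b X xi) x.
Proof.
move=> Wx dX sxi; apply: differentiableD; first exact: differentiable_derive_along.
apply: differentiable_chr_along => //; first exact: differentiable_pushf.
exact: smooth_on_differentiable sxi Wx.
Qed.

(** The product rule of conjugate connections, pulled back along [u]: by the
    chain rule the metric is differentiated in the direction [u_* X]. *)
Lemma derive_met_along (g : metric N) D Db X xi eta x : is_conjugate g D Db ->
  rep_dom u a b x -> differentiable xi x -> differentiable eta x ->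
  'D_(X x) (fun z => g b (rep u a b z) (xi z) (eta z)) x =
  g b (rep u a b x) (cov_along u D a b X xi x) (eta x)
  + g b (rep u a b x) (xi x) (cov_along u Db a b X eta x).
Proof.
move=> cD Wx dxi deta; have bx := rep_chart_im Wx.
have drep := smooth_on_differentiable smooth_rep Wx.
have dg (v w : 'rV[R]_n) : differentiable (fun y => g b y v w : R^o) (rep u a b x).
  exact: smooth_on_differentiable (met_smooth g b v w) bx.
have lB : \forall z \near x, bilin (g b (rep u a b z) : _ -> _ -> R^o).
  by apply: filterS (near_rep_dom Wx) => z Wz; exact/met_bilin/rep_chart_im.
have dB (v w : 'rV[R]_n) : differentiable (fun z => g b (rep u a b z) v w : R^o) x.
  exact: (@differentiable_comp _ _ _ _ (rep u a b) (fun y => g b y v w : R^o)).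
have [_ E] := bilinear_family_is_diff lB dB dxi deta.
have hg := met_bilin g bx.
have -> := E (X x).
have -> : 'D_(X x) (fun z => g b (rep u a b z) (xi x) (eta x)) x =
    'D_('D_(X x) (rep u a b) x) (fun y => g b y (xi x) (eta x)) (rep u a b x).
  exact: (@derive_comp _ _ _ _ (rep u a b) (fun y => g b y (xi x) (eta x) : R^o)).
rewrite (conjugate_chr _ _ _ cD bx) /cov_along (bilinDl hg) (bilinDr hg) /pushf.
lra.
Qed.

End AlongMap.

(** * The cubic form of the induced structure *)

(** The linear algebra behind the comparison of the two covariant derivatives
    of the metric: [cw], [cy] come from the Levi-Civita connection and [kw], [ky]
    from the difference tensor. *)
Lemma polarized_cubic (R : realType) (V : lmodType R) (h : V -> V -> R^o) (k : R)
    (nw cw kw ny cy ky tw ty : V) : bilin h ->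
  nw = cw + kw -> ny = cy + ky -> h kw ty = h tw ky ->
  h cw ty + h tw cy - h nw ty - h tw ny = - (k + k) -> k = h kw ty.
Proof.
move=> hh -> -> adj; rewrite (bilinDl hh) (bilinDr hh) -adj.
move: (h cw ty : R) (h tw cy : R) (h kw ty : R) => r1 r2 r3; lra.
Qed.

Section InducedStructure.
Context {R : realType} {m n : nat} {M : manifold R m} {N : manifold R n}.
Context (SM : statistical_structure M) (SN : statistical_structure N).
Context (u : M -> N) (su : smooth_map u) (ind : induced_structure SM SN u).
Context (a : atlas M) (b : atlas N).

Local Notation rho := (rep u a b).

(** The cubic form [g(K(v, w), y)] is [-1/2 (nabla_v g)(w, y)], and the
    covariant derivative of the metric only involves the metric and the
    tangential part of the connection, both of which are pulled back by [u]. *)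
Lemma diff_tensor_pullback x v w y : rep_dom u a b x ->
  smet SM a x (diff_tensor SM a x v w) y =
  smet SN b (rho x) (diff_tensor SN b (rho x) ('D_v rho x) ('D_w rho x))
    ('D_y rho x).
Proof.
move=> Wx; have ax := rep_dom_sub Wx; have bx := rep_chart_im Wx.
have hh := met_bilin (smet SN) bx.
have EM := cov_met_cubic SM v w y ax.
rewrite -(diff_tensor_adjoint SM v w y ax) in EM.
have smc (z : 'rV[R]_m) : smooth_on (rep_dom u a b) (cst z) by exact: smooth_on_cst.
have sub0 : rep_dom u a b `<=` rep_dom u a b by [].
have oW : open (rep_dom u a b) by exact: rep_dom_open.
have Ew := ind.2 a b _ _ _ _ oW sub0 (smc v) (smc w) (smc y) x Wx.
have Ey := ind.2 a b _ _ _ _ oW sub0 (smc v) (smc y) (smc w) x Wx.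
have dT z : differentiable (pushf u a b (cst z)) x.
  by apply: differentiable_pushf => //; exact: differentiable_cst.
have Dg := derive_met_along su (cst v) (levi_civita_conjugate (nablagP SN)) Wx
  (dT w) (dT y).
have E : cov_met (nabla SM) (smet SM) a (cst v) (cst w) (cst y) x =
    smet SN b (rho x) (cov_along u (nablag SN) a b (cst v) (pushf u a b (cst w)) x)
      (pushf u a b (cst y) x)
    + smet SN b (rho x) (pushf u a b (cst w) x)
      (cov_along u (nablag SN) a b (cst v) (pushf u a b (cst y)) x)
    - smet SM a x (cov (nabla SM) a (cst v) (cst w) x) y
    - smet SM a x w (cov (nabla SM) a (cst v) (cst y) x).
  rewrite /cov_met -Dg /deriv_met; do 2 congr (_ - _).
  apply: near_eq_derive; apply: filterS (near_rep_dom su Wx) => z Wz.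
  exact: ind.1.
have Ey' : smet SM a x w (cov (nabla SM) a (cst v) (cst y) x) =
    smet SN b (rho x) (pushf u a b (cst w) x)
      (cov_along u (nabla SN) a b (cst v) (pushf u a b (cst y)) x).
  by rewrite (met_sym _ _ _ ax) [LHS]Ey; exact: met_sym.
rewrite E Ew Ey' in EM.
have covE z : cov_along u (nabla SN) a b (cst v) (pushf u a b (cst z)) x =
    cov_along u (nablag SN) a b (cst v) (pushf u a b (cst z)) x
    + diff_tensor SN b (rho x) ('D_v rho x) ('D_z rho x).
  by rewrite diff_tensorE /cov_along -addrA [nablag _ _ _ _ _ + _]addrC subrK.
have adj := diff_tensor_adjoint SN ('D_v rho x) ('D_w rho x) ('D_y rho x) bx.
exact: polarized_cubic hh (covE w) (covE y) adj EM.
Qed.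

End InducedStructure.

(** * The tension field of a hypersurface *)

Section Hypersurface.
Context {R : realType} {m : nat} {M : manifold R m} {N : manifold R m.+1}.
Context (SM : statistical_structure M) (SN : statistical_structure N).
Context (u : M -> N) (su : smooth_map u) (ind : induced_structure SM SN u).
Context (a : atlas M) (b : atlas N) (e : 'I_m -> 'rV[R]_m -> 'rV[R]_m).
Context (oe : orthonormal_frame (smet SM) a (rep_dom u a b) e).
Context (xi : 'rV[R]_m -> 'rV[R]_m.+1) (sxi : smooth_on (rep_dom u a b) xi).
Context (tension : forall x, rep_dom u a b x ->
  xi x = tension_in_frame SM SN u a b e x).

Local Notation W := (rep_dom u a b).
Local Notation rho := (rep u a b).
Local Notation h x := (smet SN b (rep u a b x)).
Local Notation K x := (diff_tensor SN b (rep u a b x)).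
Local Notation T i := (pushf u a b (e i)).
Local Notation cov_u X eta := (cov_along u (nabla SN) a b X eta).
Local Notation cov_ubar X eta := (cov_along u (nablabar SN) a b X eta).

Let hh x : W x -> bilin (h x : _ -> _ -> R^o).
Proof. by move=> Wx; exact/met_bilin/rep_chart_im. Qed.

Let hsym x v w : W x -> h x v w = h x w v.
Proof. by move=> Wx; apply: met_sym; exact: rep_chart_im. Qed.

Let drho x : W x -> differentiable rho x.
Proof. exact/smooth_on_differentiable/smooth_rep. Qed.

Let de i x : W x -> differentiable (e i) x.
Proof. exact/smooth_on_differentiable/oe.1. Qed.

Let dT i x : W x -> differentiable (T i) x.
Proof. by move=> Wx; apply: differentiable_pushf => //; exact: de. Qed.

Let dxi x : W x -> differentiable xi x.
Proof. exact: smooth_on_differentiable. Qed.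

Lemma pushf_orthonormal x i j : W x -> h x (T i x) (T j x) = (i == j)%:R.
Proof. by move=> Wx; rewrite -ind.1// oe.2. Qed.

Lemma tension_normal_frame x j : W x -> h x (xi x) (T j x) = 0.
Proof.
move=> Wx; rewrite tension// (bilin_suml (hh Wx)) big1// => i _.
have oW : open W by exact: rep_dom_open.
have := ind.2 a b W _ _ _ oW (@subset_refl _ W) (oe.1 i) (oe.1 i) (oe.1 j) x Wx.
rewrite (bilinBl (hh Wx)) => <-.
by rewrite -ind.1// subrr.
Qed.

(** The tension field of an isometric immersion whose connection is induced is
    normal: it is the trace of the normal part of the derivative of [u_*]. *)
Lemma tension_normal x v : W x -> h x (xi x) ('D_v rho x) = 0.
Proof.
move=> Wx; have ax := rep_dom_sub Wx.
rewrite (orthonormal_expansion (met_bilin (smet SM) ax) (oe.2 x Wx) v).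
rewrite (lin_sum _ _ (derive_linear (drho Wx))) (bilin_sumr (hh Wx)) big1// => j _.
rewrite (linZ _ _ (derive_linear (drho Wx))) (bilinZr (hh Wx)).
by rewrite [h x _ _](tension_normal_frame j Wx) scaler0.
Qed.

(** Differentiating [h(xi, d rho(e_j)) = 0]. *)
Lemma second_fundamental x i j : W x ->
  h x (cov_ubar (e i) xi x) (T j x) = - h x (cov_u (e i) (T j) x) (xi x).
Proof.
move=> Wx.
have := derive_met_along su (e i) (@nablabarP _ _ _ SN) Wx (dT j Wx) (dxi Wx).
have -> : 'D_(e i x) (fun z => h z (T j z) (xi z)) x = 0.
  rewrite -(derive_cst (0 : R) x (e i x)); apply: near_eq_derive.
  apply: filterS (near_rep_dom su Wx) => z Wz.
  by rewrite hsym// tension_normal_frame.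
rewrite [h x (T j x) _]hsym// => /esym/eqP.
by rewrite addr_eq0 => /eqP->; rewrite opprK.
Qed.

(** The tangential correction in the tension field is orthogonal to [xi], so the
    trace of the second fundamental form in the direction [xi] is [|xi|^2]. *)
Lemma tension_normsq x : W x ->
  \sum_i h x (cov_u (e i) (T i) x) (xi x) = h x (xi x) (xi x).
Proof.
move=> Wx; transitivity (h x (tension_in_frame SM SN u a b e x) (xi x)).
  rewrite (bilin_suml (hh Wx)).
  apply: eq_bigr => i _; rewrite (bilinBl (hh Wx)).
  by rewrite [X in _ - X]hsym// [X in _ - X](tension_normal _ Wx) subr0.
by rewrite -tension.
Qed.

Lemma cov_ubarE X x : W x ->
  cov_ubar X xi x = cov_u X xi x - K x ('D_(X x) rho x) (xi x) *+ 2.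
Proof.
move=> Wx; rewrite /cov_along nablabar_diff ?addrA//.
exact: rep_chart_im.
Qed.

Context (Kxi : forall x, W x -> K x (xi x) (xi x) = 0).

Lemma K_normal x w : W x -> h x (K x w (xi x)) (xi x) = 0.
Proof.
move=> Wx; have bx := rep_chart_im Wx.
rewrite (diff_tensor_sym _ _ _ bx) (diff_tensor_adjoint _ _ _ _ bx) Kxi//.
exact: (bilin0r (hh Wx)).
Qed.

Context (c : R).
Context (xi_norm : forall x, W x -> h x (xi x) (xi x) = c).

(** The derivative of the constant [h(xi, xi)] is the sum of the two products
    below, and their difference is a value of the cubic form at [xi, xi]. *)
Lemma cov_xi_normal X x : W x -> h x (cov_u X xi x) (xi x) = 0 /\
  h x (cov_ubar X xi x) (xi x) = 0.
Proof.
move=> Wx; have bx := rep_chart_im Wx.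
have := derive_met_along su X (@nablabarP _ _ _ SN) Wx (dxi Wx) (dxi Wx).
have -> : 'D_(X x) (fun z => h z (xi z) (xi z)) x = 0.
  rewrite -(derive_cst (c : R) x (X x)); apply: near_eq_derive.
  by apply: filterS (near_rep_dom su Wx) => z Wz; exact: xi_norm.
have -> : h x (xi x) (cov_ubar X xi x) = h x (cov_ubar X xi x) (xi x).
  exact: hsym.
have : h x (cov_ubar X xi x) (xi x) = h x (cov_u X xi x) (xi x).
  rewrite cov_ubarE// (bilinBl (hh Wx)) mulr2n [X in _ - X](bilinDl (hh Wx)).
  by rewrite K_normal// addr0 subr0.
move=> -> /esym E; suff : h x (cov_u X xi x) (xi x) = 0 by [].
lra.
Qed.

Context (c_neq0 : c != 0).

(** An orthonormal basis of the tangent space of [N] whose normal vector has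
    index [ord0]; it exists because [M] has codimension one. *)
Definition adapted_frame x (j : 'I_m.+1) : 'rV[R]_m.+1 :=
  if unlift ord0 j is Some i then T i x else (Num.sqrt c)^-1 *: xi x.

Let c_gt0 x : W x -> 0 < c.
Proof.
move=> Wx; rewrite -(xi_norm Wx); apply: (met_pos _ (rep_chart_im Wx)).
apply: contra_neq c_neq0 => xi0; rewrite -(xi_norm Wx) xi0.
exact: (bilin0l (hh Wx)).
Qed.

Lemma adapted_frame_lift x i : adapted_frame x (lift ord0 i) = T i x.
Proof. by rewrite /adapted_frame liftK. Qed.

Lemma adapted_frame0 x : adapted_frame x ord0 = (Num.sqrt c)^-1 *: xi x.
Proof. by rewrite /adapted_frame unlift_none. Qed.

Lemma adapted_orthonormal x : W x ->
  Defs.orthonormal (smet SN) b (rho x) (adapted_frame x).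
Proof.
move=> Wx i j.
have E0 k : h x (adapted_frame x ord0) (T k x) = 0.
  by rewrite adapted_frame0 (bilinZl (hh Wx)) tension_normal_frame// scaler0.
case: (unliftP ord0 i) => [i'|] ->; case: (unliftP ord0 j) => [j'|] ->.
- by rewrite !adapted_frame_lift pushf_orthonormal// (inj_eq (@lift_inj _ ord0)).
- by rewrite adapted_frame_lift hsym// E0.
- by rewrite adapted_frame_lift E0.
- rewrite !adapted_frame0 (bilinZl (hh Wx)) (bilinZr (hh Wx)) xi_norm//.
  rewrite /GRing.scale/= mulrA -expr2 exprVn sqr_sqrtr ?ltW ?(c_gt0 Wx)//.
  by rewrite mulVf.
Qed.

Let K_frame0 x : W x -> K x (xi x) (adapted_frame x ord0) = 0.
Proof.
move=> Wx; rewrite adapted_frame0.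
by rewrite (bilinZr (diff_tensor_bilin SN (rep_chart_im Wx))) Kxi// scaler0.
Qed.

(** The normal direction contributes nothing to the trace of [K]. *)
Lemma trace_tangential x : trace_free SN -> W x ->
  \sum_i K x (T i x) (T i x) = 0.
Proof.
move=> tSN Wx; have bx := rep_chart_im Wx.
have := tSN b (rho x) (adapted_frame x) bx (adapted_orthonormal Wx).
rewrite big_ord_recl adapted_frame0 (bilinZl (diff_tensor_bilin SN bx)).
rewrite (bilinZr (diff_tensor_bilin SN bx)) Kxi// !scaler0 add0r => E.
by rewrite -[RHS]E; apply: eq_bigr => i _; rewrite adapted_frame_lift.
Qed.

(** The cubic form of [M] is the pull-back of that of [N], so [tr_g K^M] is dual
    to the tangential trace of [K^N]. *)
Lemma tr_diff_eq0 x : trace_free SN -> W x -> tr_diff SM a e x = 0.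
Proof.
move=> tSN Wx; have ax := rep_dom_sub Wx.
apply: (met_nondegenerate (g := smet SM) ax) => y.
rewrite (met_sym _ _ _ ax) (bilin_suml (met_bilin (smet SM) ax)).
under eq_bigr do rewrite diff_fieldE (diff_tensor_pullback su ind _ _ _ Wx).
by rewrite -(bilin_suml (hh Wx)) trace_tangential// (bilin0l (hh Wx)).
Qed.

Lemma divg_tr_diff_eq0 x : trace_free SN -> W x ->
  divg SM a (tr_diff SM a e) x = 0.
Proof.
move=> tSN Wx; have ax := rep_dom_sub Wx.
rewrite /divg (_ : (fun v => _) = fun _ => 0).
  by rewrite /mxtrace big1// => i _; rewrite !mxE.
apply/funext => v; rewrite /cov tr_diff_eq0//.
rewrite (bilin0r (chr_bilin (nablag SM) ax)) addr0 -(derive_cst (0 : 'rV[R]_m) x v).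
apply: near_eq_derive; apply: filterS (near_rep_dom su Wx) => z Wz.
exact: tr_diff_eq0.
Qed.

(** Differentiating [h(xi, nablabar_{e_i} xi) = 0]. *)
Lemma laplace_normal x : W x ->
  h x (laplace_bar SM SN u a b e xi x) (xi x) =
  - \sum_i h x (cov_u (e i) xi x) (cov_ubar (e i) xi x).
Proof.
move=> Wx; rewrite (bilin_suml (hh Wx)) -sumrN; apply: eq_bigr => i _.
rewrite (bilinBl (hh Wx)) [X in _ - X](cov_xi_normal _ Wx).2 subr0 hsym//.
have dcov : differentiable (cov_ubar (e i) xi) x.
  by apply: differentiable_cov_along => //; exact: de.
have := derive_met_along su (e i) (@nablabarP _ _ _ SN) Wx (dxi Wx) dcov.
have -> : 'D_(e i x) (fun z => h z (xi z) (cov_ubar (e i) xi z)) x = 0.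
  rewrite -(derive_cst (0 : R) x (e i x)); apply: near_eq_derive.
  apply: filterS (near_rep_dom su Wx) => z Wz.
  by rewrite hsym//; exact: (cov_xi_normal _ Wz).2.
by move=> /esym/eqP; rewrite addrC addr_eq0 => /eqP.
Qed.

Local Notation B x i j := (h x (cov_u (e i) (T j) x) (xi x)).
Local Notation kappa x i j := (h x (K x (T i x) (xi x)) (T j x)).

(** Both covariant derivatives of [xi] are tangential. *)
Lemma cov_xi_inner x i : W x ->
  h x (cov_u (e i) xi x) (cov_ubar (e i) xi x) =
  \sum_j B x i j * (B x i j - 2 * kappa x i j).
Proof.
move=> Wx; have bx := rep_chart_im Wx.
rewrite (parseval (hh Wx) (fun _ _ => hsym _ _ Wx) (adapted_orthonormal Wx)).
rewrite big_ord_recl adapted_frame0 (bilinZr (hh Wx)).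
rewrite [h x _ _](cov_xi_normal _ Wx).1 scaler0 mul0r add0r.
apply: eq_bigr => j _; rewrite !adapted_frame_lift.
have E : h x (cov_u (e i) xi x) (T j x) =
    h x (cov_ubar (e i) xi x) (T j x) + 2 * kappa x i j.
  rewrite [in RHS]cov_ubarE// (bilinBl (hh Wx)) mulr2n [X in _ - X](bilinDl (hh Wx)).
  rewrite /pushf; move: (h x _ _ : R) (h x _ _ : R) => r1 r2; lra.
by rewrite E second_fundamental// mulrC mulNr -mulrN opprD opprK addrC.
Qed.

(** The conjugate curvatures are adjoint to each other up to sign, and the
    normal component of the trace vanishes since [xi] is itself normal. *)
Lemma interchange_trace x : W x ->
  \sum_i h x (Defs.interchange SN b (rho x) (T i x) (xi x) (T i x)) (xi x) =
  - Ric (nablabar SN) b (rho x) (xi x) (xi x).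
Proof.
move=> Wx; have bx := rep_chart_im Wx; have oE := adapted_orthonormal Wx.
rewrite (Ric_orthonormal _ _ _ bx oE) big_ord_recl adapted_frame0.
have lc := curv_linearl (nablabar SN) (xi x) (xi x) bx.
rewrite [curv _ _ _ (_ *: _) _ _](linZ _ _ lc) curv_diag// scaler0.
rewrite (bilin0l (hh Wx)) add0r -sumrN; apply: eq_bigr => i _.
rewrite adapted_frame_lift (interchangeP _ _ _ _ bx oE).
rewrite (curv_conjugate _ _ _ _ (@nablabarP _ _ _ SN) bx).
by congr (- _); exact: hsym.
Qed.

(** [K(xi, _)] is self-adjoint and kills [xi], so its norm is that of its
    tangential block [kappa]. *)
Lemma K_xi_normsq x : W x ->
  \sum_j h x (K x (xi x) (adapted_frame x j)) (K x (xi x) (adapted_frame x j))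
  = \sum_i \sum_j kappa x i j ^+ 2.
Proof.
move=> Wx; have bx := rep_chart_im Wx.
rewrite big_ord_recl K_frame0// (bilin0l (hh Wx)) add0r.
apply: eq_bigr => i _; rewrite adapted_frame_lift (diff_tensor_sym _ _ _ bx).
rewrite (parseval (hh Wx) (fun _ _ => hsym _ _ Wx) (adapted_orthonormal Wx)).
rewrite big_ord_recl adapted_frame0 (bilinZr (hh Wx)) [h x _ _](K_normal _ Wx).
rewrite scaler0 mul0r add0r; apply: eq_bigr => j _.
by rewrite adapted_frame_lift expr2.
Qed.

Lemma trace_kappa x : trace_free SN -> W x -> \sum_i kappa x i i = 0.
Proof.
move=> tSN Wx; have bx := rep_chart_im Wx.
rewrite -[RHS](bilin0r (hh Wx) (xi x)) -(trace_tangential tSN Wx).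
by rewrite (bilin_sumr (hh Wx)); apply: eq_bigr => i _; exact: diff_tensor_adjoint.
Qed.

(** The bitension field has a nonzero inner product with [xi]: were it zero, the
    nonnegative sum of the squares of [B - kappa] would vanish by the curvature
    assumption, against the values of the traces of [B] and [kappa]. *)
Lemma bitension_neq0 x : trace_free SN ->
  (forall v, 0 <= Ric (nabla SN) b (rho x) v v - Ric (nablabar SN) b (rho x) v v
                  - 2 * Ric (nablag SN) b (rho x) v v) ->
  W x -> bitension_in_frame SM SN u a b e xi x != 0.
Proof.
move=> tSN /(_ (xi x)) hRic Wx; apply: contra_neqN c_neq0 => /eqP bi.
have bx := rep_chart_im Wx.
have Rs := Ric_sum (xi x) tSN bx (adapted_orthonormal Wx).
rewrite (K_xi_normsq Wx) in Rs.
have : h x (bitension_in_frame SM SN u a b e xi x) (xi x) = 0.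
  by rewrite bi (bilin0l (hh Wx)).
rewrite /bitension_in_frame divg_tr_diff_eq0// scale0r addr0 Kxi// subr0.
rewrite (bilinBl (hh Wx)) [X in _ - X](bilin_suml (hh Wx)) interchange_trace//.
rewrite laplace_normal//.
under eq_bigr do rewrite cov_xi_inner//.
move=> E.
have S0 : \sum_i \sum_j (B x i j - kappa x i j) ^+ 2 <= 0.
  have -> : \sum_i \sum_j (B x i j - kappa x i j) ^+ 2 =
      \sum_i \sum_j B x i j * (B x i j - 2 * kappa x i j)
      + \sum_i \sum_j kappa x i j ^+ 2.
    rewrite -big_split; apply: eq_bigr => i _; rewrite -big_split.
    by apply: eq_bigr => j _ /=; ring.
  lra.
have B_kappa i : B x i i = kappa x i i.
  have sq0 j k : 0 <= (B x j k - kappa x j k) ^+ 2 by exact: sqr_ge0.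
  have s0 j : 0 <= \sum_k (B x j k - kappa x j k) ^+ 2 by exact: sumr_ge0.
  have /eqP : \sum_i \sum_j (B x i j - kappa x i j) ^+ 2 = 0.
    by apply/eqP; rewrite eq_le S0 sumr_ge0.
  rewrite psumr_eq0// => /allP/(_ i (mem_index_enum _))/=.
  rewrite psumr_eq0// => /allP/(_ i (mem_index_enum _))/=.
  by rewrite sqrf_eq0 subr_eq0 => /eqP.
rewrite -(xi_norm Wx) -(tension_normsq Wx) -[RHS](trace_kappa tSN Wx).
by apply: eq_bigr => i _; exact: B_kappa.
Qed.

End Hypersurface.

(** * Vanishing of the tension field *)

Theorem proposition5p4 (R : realType) (m n : nat) (hm : (2 <= m)%N)
    (M : manifold R m) (N : manifold R n)
    (SM : statistical_structure M) (SN : statistical_structure N)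
    (u : M -> N) (hu : statistical_hypersurface SM SN u)
    (htf : trace_free SN)
    (hRic : forall (b : atlas N) (y v : 'rV[R]_n), chart_im b y ->
      0 <= Ric (nabla SN) b y v v - Ric (nablabar SN) b y v v
           - 2 * Ric (nablag SN) b y v v)
    (hbi : statistical_biharmonic SM SN u)
    (tau : section_along u) (htau : is_tension_field SM SN tau)
    (hK : forall (b : atlas N) (p : M), dom b (u p) ->
      diff_tensor SN b (chart b (u p)) (tau b p) (tau b p) = 0)
    (hconst : exists c : R, forall (b : atlas N) (p : M), dom b (u p) ->
      Num.sqrt (smet SN b (chart b (u p)) (tau b p) (tau b p)) = c) :
  forall (b : atlas N) (p : M), dom b (u p) -> tau b p = 0.
Proof.
case: hu => -[su _] ind nm; subst n => b p bp.
have [c hc] := hconst; have [a ap] := dom_cover p.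
pose x := chart a p; have Wx : rep_dom u a b x by exists p.
have oW : open (rep_dom u a b) by exact: rep_dom_open.
have sW : rep_dom u a b `<=` rep_dom u a b by [].
have [e oe] := orthonormal_frame_exists (smet SM) oW (@rep_dom_sub _ _ _ _ _ u a b).
pose xi z := tau b (param a z).
have uW z : rep_dom u a b z -> dom b (u (param a z)).
  by move=> [q [aq bq] <-]; rewrite chartK.
have tens z : rep_dom u a b z -> xi z = tension_in_frame SM SN u a b e z.
  exact: htau.
have normsq z : rep_dom u a b z ->
    smet SN b (rep u a b z) (xi z) (xi z) = c ^+ 2.
  move=> Wz; rewrite -(hc b (param a z) (uW z Wz)) sqr_sqrtr//.
  have [->|xi0] := eqVneq (tau b (param a z)) 0.
    by rewrite (bilin0l (met_bilin (smet SN) (rep_chart_im Wz))).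
  exact/ltW/met_pos/xi0/rep_chart_im.
have c0 : c ^+ 2 = 0.
  apply/eqP/negPn/negP => c0.
  have Kxi z : rep_dom u a b z -> diff_tensor SN b (rep u a b z) (xi z) (xi z) = 0.
    by move=> /uW; exact: hK.
  have sxi : smooth_on (rep_dom u a b) xi by exact: sec_smooth.
  have hRicx v := hRic b _ v (rep_chart_im Wx).
  have := bitension_neq0 su ind oe sxi tens Kxi normsq c0 htf hRicx Wx.
  by rewrite (hbi.2 tau htau a b _ e oW sW oe x Wx) eqxx.
apply/eqP/negPn/negP => tau0.
have := met_pos (smet SN) (rep_chart_im Wx) tau0.
have := normsq x Wx; rewrite /xi /x chartK// c0 => ->; by rewrite ltxx.
Qed.
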